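(* Let $\varepsilon_0,\mu_0,\Omega_e,\Omega_m,\alpha_e,\alpha_m$ be strictly positive real numbers. For $(\mathbf{E}_0,\mathbf{H}_0)\in L^2(\mathbb{R}^3)^3\times L^2(\mathbb{R}^3)^3$, let $(\mathbf{E},\mathbf{H},\partial_t\mathbf{P},\partial_t\mathbf{M})\in C^0(\mathbb{R}^+,L^2(\mathbb{R}^3)^{12})$ be the unique mild solution of the dissipative Drude system $$\begin{cases}\varepsilon_0\,\partial_t\mathbf{E}-\nabla\times\mathbf{H}+\varepsilon_0\,\Omega_e^2\,\partial_t\mathbf{P}=0,\\ \mu_0\,\partial_t\mathbf{H}+\nabla\times\mathbf{E}+\mu_0\,\Omega_m^2\,\partial_t\mathbf{M}=0,\\ \partial_t^2\mathbf{P}+\alpha_e\,\partial_t\mathbf{P}=\mathbf{E},\\ \partial_t^2\mathbf{M}+\alpha_m\,\partial_t\mathbf{M}=\mathbf{H},\end{cases}\qquad (\mathbf{x},t)\in\mathbb{R}^3\times\mathbb{R}^+,$$ with initial conditions $\mathbf{E}(\cdot,0)=\mathbf{E}_0$, $\mathbf{H}(\cdot,0)=\mathbf{H}_0$, $\partial_t\mathbf{P}(\cdot,0)=\partial_t\mathbf{M}(\cdot,0)=0$, and define the total energy $$\mathcal{L}(t):=\frac12\Big(\varepsilon_0\|\mathbf{E}(\cdot,t)\|_{L^2(\mathbb{R}^3)}^2+\mu_0\|\mathbf{H}(\cdot,t)\|_{L^2(\mathbb{R}^3)}^2+\varepsilon_0\Omega_e^2\|\partial_t\mathbf{P}(\cdot,t)\|_{L^2(\mathbb{R}^3)}^2+\mu_0\Omega_m^2\|\partial_t\mathbf{M}(\cdot,t)\|_{L^2(\mathbb{R}^3)}^2\Big).$$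 Then: 1. For any $(\mathbf{E}_0,\mathbf{H}_0)\in L^2(\mathbb{R}^3)^3\times L^2(\mathbb{R}^3)^3$, one has $\lim_{t\to+\infty}\mathcal{L}(t)=0$. 2. For every integer $m>0$ there is a constant $C>0$, depending only on $m$ and on $\varepsilon_0,\mu_0,\Omega_e,\Omega_m,\alpha_e,\alpha_m$, such that if $(\mathbf{E}_0,\mathbf{H}_0)\in H^m(\mathbb{R}^3)^3\times H^m(\mathbb{R}^3)^3$, then for all $t>0$ $$\mathcal{L}(t)\le C\,\Big(\|\mathbf{E}_0\|_{H^m(\mathbb{R}^3)}^2+\|\mathbf{H}_0\|_{H^m(\mathbb{R}^3)}^2\Big)\,t^{-m}.$$
   Context: $\mathbb{R}^+=[0,+\infty)$. The unknowns are the electric and magnetic fields $\mathbf{E},\mathbf{H}$ and the time derivatives $\partial_t\mathbf{P},\partial_t\mathbf{M}$ of the polarization and magnetization terms; all are functions of $(\mathbf{x},t)\in\mathbb{R}^3\times\mathbb{R}^+$ with values in $\mathbb{R}^3$. The system is viewed as a first-order linear evolution problem for $\mathbf{U}=(\mathbf{E},\mathbf{H},\partial_t\mathbf{P},\partial_t\mathbf{M})$ in the Hilbert space $L^2(\mathbb{R}^3)^3\times L^2(\mathbb{R}^3)^3\times L^2(\mathbb{R}^3)^3\times L^2(\mathbb{R}^3)^3$ (the operator having domain $H(\mathrm{rot};\mathbb{R}^3)\times H(\mathrm{rot};\mathbb{R}^3)\times L^2(\mathbb{R}^3)^3\times L^2(\mathbb{R}^3)^3$, where $H(\mathrm{rot};\mathbb{R}^3)=\{\mathbf{v}\in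 L^2(\mathbb{R}^3)^3 : \nabla\times\mathbf{v}\in L^2(\mathbb{R}^3)^3\}$), which generates a $C^0$ semigroup; the mild solution is the one given by this semigroup applied to $(\mathbf{E}_0,\mathbf{H}_0,0,0)$. *)

(* Defs.v *)
From HB Require Import structures.
From mathcomp Require Import all_boot all_order all_algebra.
From mathcomp Require Import all_classical all_reals all_analysis.

Set Implicit Arguments.
Unset Strict Implicit.
Unset Printing Implicit Defensive.

Import Order.TTheory GRing.Theory Num.Theory.
Import numFieldNormedType.Exports.

Local Open Scope classical_set_scope.
Local Open Scope ring_scope.

(* C^0 semigroups of bounded linear operators, for a space presented as a
   vector space X with a seminorm N, two vectors being identified when the
   seminorm of their difference vanishes.  Below, X consists of square-integrable
   functions and N is the L^2 norm, so that the identification is equality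
   almost everywhere. *)
Section Semigroup.
Context (R : realType) (X : lmodType R) (N : X -> R).
Implicit Types (T : R -> X -> X) (G : X -> X -> Prop).

Definition null_eq (u v : X) : Prop := N (u - v) = 0.

(* Only the operators T t with 0 <= t are meaningful. *)
Record C0_semigroup T : Prop := {
  semigroup_linear : forall t, 0 <= t -> forall (a : R) (u v : X),
    null_eq (T t (a *: u + v)) (a *: T t u + T t v) ;
  semigroup_bounded : forall t, 0 <= t ->
    exists M : R, forall u, N (T t u) <= M * N u ;
  semigroup0 : forall u, null_eq (T 0 u) u ;
  semigroupD : forall s t, 0 <= s -> 0 <= t ->
    forall u, null_eq (T (s + t) u) (T s (T t u)) ;
  semigroup_continuous : forall u s, 0 <= s ->
    N (T t u - T s u) @[t --> within [set t | 0 <= t] (nbhs s)] --> (0 : R)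
}.

(* An unbounded operator is given by its graph: G u f means that u belongs to
   the domain and is sent to f. *)
Definition generates G T : Prop := forall u f,
  G u f <-> N (h^-1 *: (T h u - u) - f) @[h --> 0^'+] --> (0 : R).

Definition mild_solution G (u0 : X) (u : R -> X) : Prop :=
  exists T, [/\ C0_semigroup T, generates G T &
    forall t, 0 <= t -> null_eq (u t) (T t u0)].

End Semigroup.

Section Space.
Context (R : realType).

Definition space : Type :=
  (measurableTypeR R * measurableTypeR R * measurableTypeR R)%type.

Definition leb3 : {measure set space -> \bar R} :=
  ((@lebesgue_measure R \x @lebesgue_measure R) \x @lebesgue_measure R)%E.

Definition basis_vec (i : 'I_3) : R * R * R :=
  ((i == 0%N :> nat)%:R, (i == 1%N :> nat)%:R, (i == 2%N :> nat)%:R).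

Definition partial (i : 'I_3) (f : R * R * R -> R) : R * R * R -> R :=
  'D_(basis_vec i) f.

Fixpoint Cn (n : nat) (f : R * R * R -> R) : Prop :=
  continuous f /\
  if n is n'.+1 then
    (forall i x, derivable f x (basis_vec i)) /\ (forall i, Cn n' (partial i f))
  else True.

Definition test_function (phi : R * R * R -> R) : Prop :=
  (forall n, Cn n phi) /\ compact (closure [set x | phi x != 0]).

Definition L2 := LfunType leb3 (lee1n 2).

Definition L2norm (f : L2) : R := fine ('N[leb3]_2%:E[EFin \o f])%E.

Definition pairing (f : L2) (phi : R * R * R -> R) : R :=
  (\int[leb3]_x (f x * phi x))%R.

Definition multi_index := {ffun 'I_3 -> nat}.

Definition mi_order (a : multi_index) : nat := (\sum_i a i)%N.

Definition iter_partial (a : multi_index) (phi : R * R * R -> R) :=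
  iter (a ord0) (partial ord0) (iter (a (inord 1)) (partial (inord 1))
    (iter (a ord_max) (partial ord_max) phi)).

Definition is_weak_derivative (a : multi_index) (f g : L2) : Prop :=
  forall phi, test_function phi ->
    pairing f (iter_partial a phi) = (-1) ^+ mi_order a * pairing g phi.

(* The weak derivative is unique up to equality almost everywhere, so the L^2
   norm of the representative picked here does not depend on the choice. *)
Definition weak_derivative (a : multi_index) (f : L2) : L2 :=
  xget 0 [set g | is_weak_derivative a f g].

Definition sobolev (m : nat) (f : L2) : Prop :=
  forall a : multi_index, (mi_order a <= m)%N ->
    exists g, is_weak_derivative a f g.

Definition to_multi_index m (a : {ffun 'I_3 -> 'I_m.+1}) : multi_index :=
  [ffun i => a i : nat].

(* Every multi-index of order at most m has its entries in 'I_m.+1. *)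
Definition sobolev_normsq (m : nat) (f : L2) : R :=
  \sum_(a : {ffun 'I_3 -> 'I_m.+1} | (mi_order (to_multi_index a) <= m)%N)
    L2norm (weak_derivative (to_multi_index a) f) ^+ 2.

Definition vfield := {ffun 'I_3 -> L2}.

Definition vnormsq (u : vfield) : R := \sum_i L2norm (u i) ^+ 2.

Definition vsobolev (m : nat) (u : vfield) : Prop := forall i, sobolev m (u i).

Definition vsobolev_normsq (m : nat) (u : vfield) : R :=
  \sum_i sobolev_normsq m (u i).

(* w is the distributional curl of u.  With j = i + 1 and k = i + 2 modulo 3,
   the i-th component of the curl is d_j u_k - d_k u_j. *)
Definition is_curl (u w : vfield) : Prop :=
  forall phi, test_function phi -> forall i : 'I_3,
    let j := ordS i in let k := ordS j in
    pairing (u k) (partial j phi) - pairing (u j) (partial k phi)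
    = - pairing (w i) phi.

(* (E, H, dP/dt, dM/dt) *)
Definition state := (vfield * vfield * vfield * vfield)%type.

Definition state_norm (U : state) : R :=
  let: (E, H, P', M') := U in
  Num.sqrt (vnormsq E + vnormsq H + vnormsq P' + vnormsq M').

(* The graph of the evolution operator; its domain is
   H(rot) x H(rot) x L^2 x L^2. *)
Definition drude_operator
    (eps0 mu0 Omega_e Omega_m alpha_e alpha_m : R) (U F : state) : Prop :=
  let: (E, H, P', M') := U in
  exists rotE rotH : vfield, [/\ is_curl E rotE, is_curl H rotH &
    null_eq state_norm F
      (eps0^-1 *: rotH - Omega_e ^+ 2 *: P',
       - (mu0^-1 *: rotE) - Omega_m ^+ 2 *: M',
       E - alpha_e *: P',
       H - alpha_m *: M')].

Definition energy (eps0 mu0 Omega_e Omega_m : R) (U : state) : R :=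
  let: (E, H, P', M') := U in
  2^-1 * (eps0 * vnormsq E + mu0 * vnormsq H
          + eps0 * Omega_e ^+ 2 * vnormsq P'
          + mu0 * Omega_m ^+ 2 * vnormsq M').

Definition drude_solution
    (eps0 mu0 Omega_e Omega_m alpha_e alpha_m : R)
    (E0 H0 : vfield) (U : R -> state) : Prop :=
  mild_solution state_norm
    (drude_operator eps0 mu0 Omega_e Omega_m alpha_e alpha_m)
    (E0, H0, 0, 0) U.

End Space.

(* Main.v *)
(* The dissipation only sees [P] and [M], but the last two equations recover [E]
   and [H] from [P], [M] and their time derivatives.  As the derivative of a
   solution is again a solution, the energies [L0], [L1] of a solution and of its
   derivative satisfy [(L0 + L1)' <= - c L0], so [L0 + L1 + c t L0] decreases and
   [L0 t] is [O(1/t)] for data in the domain of the generator; iterating this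
   gives [O(t^-m)] on the domain of the m-th power, and density of the domain
   gives decay to zero in general.

   No Fourier analysis is used to see that the maximal curl operator, defined by
   duality with test functions, is symmetric: it is deduced from the hypothesis
   that the operator generates a semigroup.  A field orthogonal to the range of
   [l - A] on test fields is turned by time reversal into an eigenvector of the
   generator for [l], which must vanish when [l] exceeds the growth rate of the
   semigroup.  Hence test fields are dense in the domain for the graph norm, the
   energy identity extends to the whole domain, and [l - A] is onto; the latter
   also yields the density of the domain. *)
Require Import Defs.
From HB Require Import structures.
From mathcomp Require Import all_boot all_order all_algebra.
From mathcomp Require Import all_classical all_reals all_analysis.
From mathcomp Require Import measurable_realfun.
From mathcomp Require Import ring lra.
Import Order.TTheory GRing.Theory Num.Theory.
Import numFieldNormedType.Exports.
Local Open Scope classical_set_scope.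
Local Open Scope ring_scope.
Set Implicit Arguments.
Unset Strict Implicit.
Unset Printing Implicit Defensive.

(** * Seminorms of inner products and the projection argument *)

(** Write the operator as [A = S - D], with [S] the conservative part and [D] the damping. Since the
    curl is weak, [A] is by construction the adjoint of [-S - D] restricted to test fields; nothing
    in this says that [<S u, u> = 0] on the whole domain, and this is the obstacle. Time reversal
    [J] flips the sign of [S] and commutes with [D], so it exchanges [A] with its formal adjoint:
    this is why a vector orthogonal to the range of [l - A] on test fields is sent by [J] to a
    solution of [A y = l y]. No contractivity is known at that stage; the only quantitative input is
    a bound [M] for the time-one operator, and an eigenvector grows by [e^l] in unit time, so
    [M < e^l] suffices. Contractivity comes afterwards, from the energy identity.

    The Lyapunov function differentiates the energies of both [u] and [A u], hence requires [u] in
    the domain of the square of the generator; a resolvent approximation removes this, so that [m]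
    orders of smoothness give [m] powers of [t]. States are functions and not classes, so all
    identities hold up to vectors of norm zero, and orbits are differentiated from the right
    only. *)

Lemma ger0_cvgr0_le (R : realType) (T : Type) (F : set_system T) {FF : Filter F} (f g : T -> R) :
  g x @[x --> F] --> (0 : R) -> (forall x, 0 <= f x) -> (\forall x \near F, f x <= g x) ->
  f x @[x --> F] --> (0 : R).
Proof.
move=> g0 f0 fg.
apply: (@squeeze_cvgr T F FF R (cst 0) g f _ 0) => //; last exact: cvg_cst.
by near=> x; rewrite f0; near: x.
Unshelve. all: by end_near. Qed.

(* Continuous induction on the set of times up to which [f s <= f a + e (s - a)]. *)
Lemma right_derivative_le0 (R : realType) (f d : R -> R) :
  (forall s : R, 0 <= s -> f t @[t --> within [set t : R | 0 <= t] (nbhs s)] --> f s) ->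
  (forall s : R, 0 <= s -> h^-1 * (f (s + h) - f s) @[h --> 0^'+] --> d s) ->
  (forall s : R, 0 <= s -> d s <= 0) ->
  forall a b : R, 0 <= a -> a <= b -> f b <= f a.
Proof.
move=> fc fd d0 a b a0 ab.
(* The slack [e] turns [d s <= 0] into a strict inequality, which is what allows a step beyond the
   supremum of [S]. *)
suff H e : 0 < e -> f b <= f a + e * (b - a).
  apply/ler_addgt0Pr => e e0.
  have e1 : 0 < e / (b - a + 1) by rewrite divr_gt0// ltr_wpDl// subr_ge0.
  apply: (le_trans (H _ e1)); rewrite lerD2l mulrAC ler_pdivrMr; last by rewrite ltr_wpDl// subr_ge0.
  by apply: ler_wpM2l; lra.
move=> e0.
pose S := [set t | a <= t <= b /\ forall s, a <= s <= t -> f s <= f a + e * (s - a)].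
have Sa : S a.
  split; first by rewrite lexx.
  by move=> s /le_anti <-; rewrite subrr mulr0 addr0.
have Sub : has_ubound S by exists b => t [/andP[_]].
have Ssup : has_sup S by split => //; exists a.
have ac : a <= sup S by exact: ub_le_sup.
have cb : sup S <= b by apply: ge_sup; [exists a|move=> t [/andP[_]]].
have below s : a <= s < sup S -> f s <= f a + e * (s - a).
  move=> /andP[as_ sc].
  have [t [_ St] st] := sup_adherent (ltac:(by rewrite subr_gt0) : 0 < sup S - s) Ssup.
  by apply: St; rewrite as_ /= ltW//; move: st; rewrite opprB addrC subrK.
have c0 : 0 <= sup S by exact: le_trans ac.
(* By continuity, a violation at [sup S] would persist at slightly earlier times, where [below]
   excludes it. *)
have Sc : f (sup S) <= f a + e * (sup S - a).
  have [->|acn] := eqVneq a (sup S); first by rewrite subrr mulr0 addr0.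
  have ac' : a < sup S by rewrite lt_neqAle acn.
  rewrite leNgt; apply/negP => cgt.
  pose g := f (sup S) - (f a + e * (sup S - a)).
  have g0 : 0 < g by rewrite subr_gt0.
  move/cvgrPdist_lt : (fc _ c0) => /(_ _ g0).
  rewrite near_withinE => -[r /= r0 Hr].
  have [s /andP[s1 s2]] : exists s, Num.max a (sup S - r) < s < sup S.
    exists ((Num.max a (sup S - r) + sup S)/2); apply/andP.
    by split; rewrite ?midf_lt// gt_max ?ac'/= ltrBlDr ltrDl.
  move: s1; rewrite gt_max => /andP[s1 s3].
  have bs : ball_ [eta Num.norm] (sup S) r s.
    by rewrite /ball_ /= ger0_norm ?subr_ge0 ?ltW//; lra.
  have := Hr s bs (ltac:(lra) : 0 <= s).
  have := below s; rewrite (ltW s1) s2 => /(_ isT) fs.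
  have es : e * (s - a) <= e * (sup S - a) by rewrite ler_pM2l// lerD2r ltW.
  rewrite ltr_norml /g => /andP[_]; lra.
have [cb'|bc] := ltP (sup S) b; last first.
  have -> : b = sup S by apply/le_anti; rewrite bc cb.
  exact: Sc.
exfalso.
move/cvgrPdist_lt : (fd _ c0) => /(_ _ e0) [r /= r0 Hr].
(* The difference quotient at [sup S] stays below [e] to the right of it, so the bound extends to
   [sup S + k], against the choice of the supremum. *)
pose k := Num.min (r / 2) (b - sup S).
have k0 : 0 < k by rewrite lt_min divr_gt0//= subr_gt0.
have kr : k < r by rewrite gt_min; apply/orP; left; lra.
have kb : k <= b - sup S by rewrite ge_min lexx orbT.
suff : S (sup S + k).
  by move=> /(ub_le_sup Sub); rewrite gerDl leNgt k0.
split; first by apply/andP; split; lra.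
move=> s /andP[as_ sk].
have [sc|] := ltP s (sup S); first by apply: below; rewrite as_.
rewrite le_eqVlt => /orP[/eqP <-//|cs].
pose h := s - sup S.
have h0 : 0 < h by rewrite subr_gt0.
have bh : ball_ [eta Num.norm] 0 r h.
  by rewrite /ball_ /= sub0r normrN gtr0_norm// /h; lra.
have := Hr h bh h0; rewrite ltr_norml => /andP[+ _].
rewrite (_ : sup S + h = s); last by rewrite /h addrC subrK.
move=> hh.
have h1 : h^-1 * (f s - f (sup S)) < e by have := d0 _ c0; lra.
have h2 : f s - f (sup S) < e * h by rewrite mulrC -ltr_pdivrMl.
rewrite /h in h2; lra.
Qed.

Section PreHilbert.
Context {R : realType} {X : lmodType R}.

(** Definiteness is left out on purpose: functions equal almost everywhere are at distance 0, and
    the dissipation form, which vanishes on purely electromagnetic states, has to be an instance. *)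
Record is_ip (ip : X -> X -> R) : Prop := {
  ipC : forall u v, ip u v = ip v u ;
  ip_linearl : forall a u v w, ip (a *: u + v) w = a * ip u w + ip v w ;
  ip_ge0 : forall u, 0 <= ip u u }.

Definition ipnorm (ip : X -> X -> R) (u : X) : R := Num.sqrt (ip u u).

Definition ip_complete (ip : X -> X -> R) := forall s : nat -> X,
  (forall e, 0 < e -> exists n0, forall n m, (n0 <= n)%N -> (n0 <= m)%N ->
    ipnorm ip (s n - s m) < e) ->
  exists x, ipnorm ip (s n - x) @[n --> \oo] --> (0 : R).

Variable ip : X -> X -> R.
Hypothesis ipP : is_ip ip.
Local Notation nrm := (ipnorm ip).

Lemma ipDl u v w : ip (u + v) w = ip u w + ip v w.
Proof. by rewrite -[u]scale1r (ip_linearl ipP) mul1r scale1r. Qed.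
Lemma ip0l w : ip 0 w = 0.
Proof. by apply: (addrI (ip 0 w)); rewrite -ipDl !addr0. Qed.
Lemma ipZl a u w : ip (a *: u) w = a * ip u w.
Proof. by rewrite -[a *: u]addr0 (ip_linearl ipP) ip0l addr0. Qed.
Lemma ipNl u w : ip (- u) w = - ip u w.
Proof. by rewrite -scaleN1r ipZl mulN1r. Qed.
Lemma ipBl u v w : ip (u - v) w = ip u w - ip v w.
Proof. by rewrite ipDl ipNl. Qed.
Lemma ipDr u v w : ip w (u + v) = ip w u + ip w v.
Proof. by rewrite (ipC ipP) ipDl !(ipC ipP w). Qed.
Lemma ip0r w : ip w 0 = 0. Proof. by rewrite (ipC ipP) ip0l. Qed.
Lemma ipZr a u w : ip w (a *: u) = a * ip w u.
Proof. by rewrite (ipC ipP) ipZl (ipC ipP w). Qed.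
Lemma ipNr u w : ip w (- u) = - ip w u.
Proof. by rewrite (ipC ipP) ipNl (ipC ipP w). Qed.
Lemma ipBr u v w : ip w (u - v) = ip w u - ip w v.
Proof. by rewrite ipDr ipNr. Qed.
Definition ipE := (ipDl, ipDr, ipNl, ipNr, ipZl, ipZr, ip0l, ip0r).

Lemma nrm_ge0 u : 0 <= nrm u. Proof. exact: sqrtr_ge0. Qed.
Lemma sqr_nrm u : nrm u ^+ 2 = ip u u. Proof. by rewrite sqr_sqrtr// ip_ge0. Qed.

Lemma ip_sqr_le u v : ip u v ^+ 2 <= ip u u * ip v v.
Proof.
have q t : 0 <= ip u u - 2 * t * ip u v + t ^+ 2 * ip v v.
  have := ip_ge0 ipP (u - t *: v); rewrite !ipE (ipC ipP v u) expr2; lra.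
have [v0|v0] := eqVneq (ip v v) 0.
  rewrite v0 mulr0.
  have [->|uv] := eqVneq (ip u v) 0; first by rewrite expr2 mulr0.
  (* Here the quadratic is affine in [t], and this [t] would give it the value -1. *)
  have := q ((ip u u + 1) / (2 * ip u v)).
  rewrite v0 mulr0 addr0.
  have -> : 2 * ((ip u u + 1) / (2 * ip u v)) * ip u v = ip u u + 1 by field.
  by move=> h; exfalso; lra.
have v1 : 0 < ip v v by rewrite lt_neqAle eq_sym v0 ip_ge0.
have := q (ip u v / ip v v).
have -> : ip u u - 2 * (ip u v / ip v v) * ip u v + (ip u v / ip v v) ^+ 2 * ip v v =
  ip u u - ip u v ^+ 2 / ip v v by field.
by rewrite subr_ge0 ler_pdivrMr.
Qed.

Lemma ip_le u v : `|ip u v| <= nrm u * nrm v.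
Proof.
rewrite -(@ler_pXn2r _ 2)// ?nnegrE ?mulr_ge0 ?nrm_ge0//.
by rewrite exprMn !sqr_nrm (real_normK (num_real _)) ip_sqr_le.
Qed.

Lemma ler_nrmD u v : nrm (u + v) <= nrm u + nrm v.
Proof.
rewrite -(@ler_pXn2r _ 2)// ?nnegrE ?addr_ge0 ?nrm_ge0//.
rewrite sqr_nrm sqrrD !sqr_nrm !ipE (ipC ipP v u).
have := ip_le u v; have := ler_norm (ip u v); rewrite mulr2n; lra.
Qed.

Lemma nrm0 : nrm 0 = 0. Proof. by rewrite /ipnorm ip0l sqrtr0. Qed.
Lemma nrmZ a u : nrm (a *: u) = `|a| * nrm u.
Proof. by rewrite /ipnorm ipZl ipZr mulrA -expr2 sqrtrM ?sqr_ge0// sqrtr_sqr. Qed.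
Lemma nrmN u : nrm (- u) = nrm u.
Proof. by rewrite -scaleN1r nrmZ normrN1 mul1r. Qed.
Lemma nrmB u v : nrm (u - v) = nrm (v - u).
Proof. by rewrite -opprB nrmN. Qed.
Lemma ler_nrmB u v w : nrm (u - w) <= nrm (u - v) + nrm (v - w).
Proof. by apply: le_trans (ler_nrmD _ _); rewrite addrA subrK. Qed.

Lemma nrm_le0 u : nrm u <= 0 -> nrm u = 0.
Proof. by move=> h; apply/le_anti; rewrite h nrm_ge0. Qed.

Lemma nrm_eq_le u v : nrm (u - v) = 0 -> nrm u <= nrm v.
Proof. by move=> h; have := ler_nrmB u v 0; rewrite !subr0 h add0r. Qed.

Lemma nrm_eq u v : nrm (u - v) = 0 -> nrm u = nrm v.
Proof.
by move=> h; apply/le_anti; rewrite !nrm_eq_le// nrmB.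
Qed.

Lemma nrm0_ip u v : nrm u = 0 -> ip u v = 0.
Proof.
move=> u0; apply/eqP; rewrite -normr_le0; apply: le_trans (ip_le _ _) _.
by rewrite u0 mul0r.
Qed.

Lemma ip_eql u v w : nrm (u - v) = 0 -> ip u w = ip v w.
Proof. by move=> /(@nrm0_ip _ w); rewrite ipBl => /eqP; rewrite subr_eq0 => /eqP. Qed.

Lemma null_eqxx u : null_eq nrm u u.
Proof. by rewrite /null_eq subrr nrm0. Qed.
Lemma null_eq_sym u v : null_eq nrm u v -> null_eq nrm v u.
Proof. by rewrite /null_eq nrmB. Qed.
Lemma null_eq_trans v u w : null_eq nrm u v -> null_eq nrm v w -> null_eq nrm u w.
Proof.
rewrite /null_eq => uv vw; apply: nrm_le0.
by apply: le_trans (ler_nrmB u v w) _; rewrite uv vw addr0.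
Qed.
Lemma null_eqD u v u' v' : null_eq nrm u v -> null_eq nrm u' v' ->
  null_eq nrm (u + u') (v + v').
Proof.
rewrite /null_eq => uv uv'; apply: nrm_le0; rewrite opprD addrACA.
by apply: le_trans (ler_nrmD _ _) _; rewrite uv uv' addr0.
Qed.
Lemma null_eqZ a u v : null_eq nrm u v -> null_eq nrm (a *: u) (a *: v).
Proof. by rewrite /null_eq -scalerBr nrmZ => ->; rewrite mulr0. Qed.

Lemma cvg_nrmD (T : Type) (F : set_system T) {FF : Filter F} (f g : T -> X) x y :
  nrm (f t - x) @[t --> F] --> (0 : R) -> nrm (g t - y) @[t --> F] --> (0 : R) ->
  nrm ((f t + g t) - (x + y)) @[t --> F] --> (0 : R).
Proof.
move=> fx gy.
have h : nrm (f t - x) + nrm (g t - y) @[t --> F] --> (0 : R).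
  by rewrite -[X in _ --> X]addr0; apply: cvgD.
apply: (ger0_cvgr0_le h) => [t|]; first exact: nrm_ge0.
by apply: nearW => t; rewrite opprD addrACA; exact: ler_nrmD.
Qed.

Lemma cvg_nrmZ (T : Type) (F : set_system T) {FF : Filter F} (f : T -> X) x a :
  nrm (f t - x) @[t --> F] --> (0 : R) ->
  nrm (a *: f t - a *: x) @[t --> F] --> (0 : R).
Proof.
move=> fx.
have : `|a| * nrm (f t - x) @[t --> F] --> `|a| * 0 by apply: cvgM => //; exact: cvg_cst.
by rewrite mulr0; under eq_fun do rewrite -nrmZ scalerBr.
Qed.

Lemma cvg_ip (T : Type) (F : set_system T) {FF : Filter F} (f g : T -> X) x y :
  nrm (f t - x) @[t --> F] --> (0 : R) -> nrm (g t - y) @[t --> F] --> (0 : R) ->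
  ip (f t) (g t) @[t --> F] --> ip x y.
Proof.
move=> fx gy.
apply/(@subr_cvg0 R R).
apply/(@norm_cvg0P R R).
have h : nrm (f t - x) * nrm (g t - y) + nrm (f t - x) * nrm y + nrm x * nrm (g t - y)
    @[t --> F] --> 0 * 0 + 0 * nrm y + nrm x * 0.
  apply: cvgD; first apply: cvgD; apply: cvgM => //; exact: cvg_cst.
rewrite mul0r mul0r mulr0 !addr0 in h.
apply: (ger0_cvgr0_le h) => //; apply: nearW => t.
have -> : ip (f t) (g t) - ip x y = ip (f t - x) (g t - y) + ip (f t - x) y + ip x (g t - y).
  by rewrite !ipE; ring.
apply: le_trans (ler_normD _ _) _; apply: lerD; last exact: ip_le.
apply: le_trans (ler_normD _ _) _; apply: lerD; exact: ip_le.
Qed.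

Lemma cvg_nrm (T : Type) (F : set_system T) {FF : Filter F} (f : T -> X) x :
  nrm (f t - x) @[t --> F] --> (0 : R) -> nrm (f t) @[t --> F] --> nrm x.
Proof.
move=> fx; have h : ip (f t) (f t) @[t --> F] --> ip x x by exact: cvg_ip.
exact: (@continuous_cvg T R R F FF _ Num.sqrt _ (@sqrt_continuous R _) h).
Qed.

Lemma nrm_cvg_unique (T : Type) (F : set_system T) {FF : ProperFilter F} (f : T -> X) x y :
  nrm (f t - x) @[t --> F] --> (0 : R) -> nrm (f t - y) @[t --> F] --> (0 : R) ->
  nrm (x - y) = 0.
Proof.
move=> fx fy.
have h : nrm (f t - x) + nrm (f t - y) @[t --> F] --> (0 : R) by rewrite -[X in _ --> X]addr0; apply: cvgD.
have : nrm (x - y) @[_ --> F] --> (0 : R).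
  apply: (ger0_cvgr0_le h); first by move=> _; exact: nrm_ge0.
  by apply: nearW => t; rewrite (nrmB (f t) x); exact: ler_nrmB.
by move/cvg_lim => <-//; rewrite lim_cst.
Qed.

(* The distance to V is minimised, as in the projection theorem, along a
   Cauchy sequence; its limit is orthogonal to V, hence null. *)
Lemma orthogonal_null_dense (V : X -> Prop) : ip_complete ip ->
  V 0 -> (forall a u v, V u -> V v -> V (a *: u + v)) ->
  (forall w, (forall v, V v -> ip w v = 0) -> nrm w = 0) ->
  forall x e, 0 < e -> exists2 v, V v & nrm (x - v) < e.
Proof.
move=> cpl V0 Vlin Vperp x e e0.
pose S := [set ip (x - v) (x - v) | v in [set v | V v]].
have Slb : has_lbound S by exists 0 => _ [v _ <-]; exact: (ip_ge0 ipP).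
have Sinf : has_inf S by split => //; exists (ip (x - 0) (x - 0)); exists 0.
pose d := inf S.
have dle v : V v -> d <= ip (x - v) (x - v) by move=> Vv; apply: ge_inf => //; exists v.
have /choice[v vP] : forall n : nat, exists v, V v /\ ip (x - v) (x - v) <= d + n.+1%:R^-1.
  move=> n; have [_ [v Vv <-] h] := inf_adherent (ltac:(by rewrite invr_gt0) : 0 < n.+1%:R^-1 :> R) Sinf.
  by exists v; split => //; exact: ltW.
pose g n := x - v n.
(* Parallelogram identity: the midpoint of [v n] and [v m] lies in [V], hence is at squared distance
   at least [d] from [x]. *)
have gpar n m : ip (g n - g m) (g n - g m) <= 2 * n.+1%:R^-1 + 2 * m.+1%:R^-1.
  have [Vn hn] := vP n; have [Vm hm] := vP m.
  have := dle (2^-1 *: v n + (2^-1 *: v m + 0)) (Vlin _ _ _ Vn (Vlin _ _ _ Vm V0)).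
  rewrite addr0.
  have -> : x - (2^-1 *: v n + 2^-1 *: v m) = 2^-1 *: (g n + g m).
    have {1}-> : x = 2^-1 *: (x + x).
      by rewrite -mulr2n -[x *+ 2]scaler_nat scalerA mulVf ?scale1r// pnatr_eq0.
    by rewrite -scalerDr -scalerBr opprD addrACA.
  move: hn hm; rewrite -/(g n) -/(g m); move: (g n) (g m) => p q.
  by rewrite !ipE (ipC ipP q p); move: n.+1%:R^-1 m.+1%:R^-1 => r s h1 h2 h3; lra.
have [n m|z gz] := cpl g.
- have e2 : 0 < n ^+ 2 by rewrite exprn_gt0.
  have [k kP] : exists k : nat, 4 * k.+1%:R^-1 < n ^+ 2.
    exists (Num.truncn (4 / n ^+ 2)).
    rewrite ltr_pdivrMr// mulrC -ltr_pdivrMr//.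
    by apply: truncnS_gt.
  exists k => p q kp kq.
  rewrite -(@ltr_pXn2r _ 2)// ?nnegrE ?nrm_ge0 ?(ltW m)// sqr_nrm.
  apply: (le_lt_trans (gpar p q)); apply: le_lt_trans kP.
  have : p.+1%:R^-1 <= k.+1%:R^-1 :> R by rewrite lef_pV2 ?posrE// ler_nat.
  have : q.+1%:R^-1 <= k.+1%:R^-1 :> R by rewrite lef_pV2 ?posrE// ler_nat.
  by move: p.+1%:R^-1 q.+1%:R^-1 k.+1%:R^-1 => a b c h1 h2; lra.
- have z0 : nrm z = 0.
    apply: Vperp => w Vw.
    have h : ip (g n) w @[n --> \oo] --> ip z w.
      apply: cvg_ip => //; under eq_fun do rewrite subrr nrm0; exact: cvg_cst.
    (* Moving [v n] along [w] by the optimal amount lowers the squared distance by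
       [ip (g n) w ^+ 2 / ip w w], so this quantity is at most the excess [n.+1%:R^-1] over the
       infimum. *)
    have h0 : ip (g n) w ^+ 2 @[n --> \oo] --> (0 : R).
      have : ip w w * harmonic n @[n --> \oo] --> ip w w * 0.
        by apply: cvgM; [exact: cvg_cst|exact: cvg_harmonic].
      rewrite mulr0 => h1; apply: (ger0_cvgr0_le h1); first by move=> n; exact: sqr_ge0.
      apply: nearW => n; rewrite /harmonic/=.
      have [Vn hn] := vP n.
      have [w0|w0] := eqVneq (ip w w) 0.
        by apply: le_trans (ip_sqr_le _ _) _; rewrite w0 mulr0 mul0r.
      have w1 : 0 < ip w w by rewrite lt_neqAle eq_sym w0 ip_ge0.
      have := dle ((ip (g n) w / ip w w) *: w + v n) (Vlin _ _ _ Vw Vn).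
      rewrite opprD addrA -addrAC -/(g n).
      move: hn; rewrite -/(g n); move: (g n) => p hn.
      rewrite !ipE (ipC ipP w p).
      move: hn w0 w1; move: (ip p w) (ip w w) (ip p p) => a b c hn w0 w1 hh.
      have {}hh : d <= c - a ^+ 2 / b.
        by apply: (le_trans hh); rewrite le_eqVlt; apply/orP; left; apply/eqP; field.
      rewrite mulrC -ler_pdivrMr//.
      by move: (n.+1%:R^-1) (a ^+ 2 / b) hn hh => s r hn hh; lra.
    have h1 : ip (g n) w ^+ 2 @[n --> \oo] --> ip z w ^+ 2 by apply: cvgM.
    have /eqP : ip z w ^+ 2 = 0 by exact: (@cvg_unique R (@norm_hausdorff R R) _ _ _ _ h1 h0).
    by rewrite sqrf_eq0 => /eqP.
  have gn0 : nrm (g n) @[n --> \oo] --> (0 : R) by rewrite -z0; exact: cvg_nrm.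
  move/cvgrPdist_lt : gn0 => /(_ _ e0) [n _ /(_ n (leqnn n))].
  rewrite sub0r normrN ger0_norm ?nrm_ge0// => hn.
  by exists (v n) => //; exact: (vP n).1.
Qed.

End PreHilbert.

Section RightDerivative.
Context {R : realType}.
Implicit Types s : R.

Lemma at_right_within s : 0 <= s ->
  s + h @[h --> 0^'+] --> within [set t : R | 0 <= t] (nbhs s).
Proof.
move=> s0 P; rewrite near_simpl /= => -[r /= r0 rP].
exists r => //= h; rewrite /ball_/= sub0r normrN => hr h0.
apply: rP; first by rewrite /ball_/= opprD addrA subrr sub0r normrN.
by rewrite addr_ge0// ltW.
Qed.

(** One-sided, because [generates] is a limit from the right and orbits are meaningful for
    nonnegative times only. *)
Definition rderive (a : R -> R) s (d : R) := h^-1 * (a (s + h) - a s) @[h --> 0^'+] --> d.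

Lemma rderiveD (a b : R -> R) s a' b' : rderive a s a' -> rderive b s b' ->
  rderive (fun t => a t + b t) s (a' + b').
Proof.
move=> ha hb; have h1 : h^-1 * (a (s + h) - a s) + h^-1 * (b (s + h) - b s) @[h --> 0^'+] --> a' + b'.
  by apply: cvgD.
apply: cvg_trans h1; apply: near_eq_cvg; apply: nearW => h /=; rewrite -mulrDr; congr (_ * _); ring.
Qed.

Lemma rderiveM (a b : R -> R) s a' b' : b (s + h) @[h --> 0^'+] --> b s ->
  rderive a s a' -> rderive b s b' ->
  rderive (fun t => a t * b t) s (a' * b s + a s * b').
Proof.
move=> cb ha hb.
have h1 : h^-1 * (a (s + h) - a s) * b (s + h) + a s * (h^-1 * (b (s + h) - b s))
   @[h --> 0^'+] --> a' * b s + a s * b'.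
  by apply: cvgD; apply: cvgM => //; exact: cvg_cst.
by apply: cvg_trans h1; apply: near_eq_cvg; apply: nearW => h /=; ring.
Qed.

Lemma rderive_id s : rderive id s 1.
Proof.
apply: cvg_near_cst; exists 1 => //= h _ h0.
by rewrite /= addrAC subrr add0r mulVf// gt_eqF.
Qed.

Lemma rderive_cst (c : R) s : rderive (fun=> c) s 0.
Proof. by apply: cvg_near_cst; apply: nearW => h; rewrite subrr mulr0. Qed.

Lemma derivable_rderive (a : R -> R) s d : is_derive s 1 a d -> rderive a s d.
Proof.
move=> [/[swap] <- ad].
have : h^-1 *: (a (h *: 1 + s) - a s) @[h --> 0^'] --> 'D_1 a s by exact: ad.
move/cvg_dnbhs_at_right => h1; apply: cvg_trans h1; apply: near_eq_cvg.
by apply: nearW => h; rewrite /= /GRing.scale/= mulr1 (addrC s).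
Qed.

End RightDerivative.

(** * Semigroups and their generators *)

Section Generator.
Context {R : realType} {X : lmodType R} (ip : X -> X -> R) (ipP : is_ip ip).
Local Notation nrm := (ipnorm ip).
Variables (T : R -> X -> X) (G : X -> X -> Prop).
Hypotheses (TS : C0_semigroup nrm T) (TG : generates nrm G T).
Implicit Types (u v f g : X) (t h : R).

Local Notation quot h u := (h^-1 *: (T h u - u)).

Lemma semigroupB t u v : 0 <= t -> null_eq nrm (T t (u - v)) (T t u - T t v).
Proof.
move=> t0; have := semigroup_linear TS t0 (-1) v u.
by rewrite !scaleN1r addrC (addrC (- T t v)).
Qed.

Lemma semigroup_lipschitz t : 0 <= t ->
  exists2 M, 0 <= M & forall u v, nrm (T t u - T t v) <= M * nrm (u - v).
Proof.
move=> t0; have [M HM] := semigroup_bounded TS t0.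
exists `|M| => // u v.
rewrite -(nrm_eq ipP (semigroupB u v t0)); apply: le_trans (HM _) _.
by apply: ler_wpM2r; [exact: nrm_ge0|exact: ler_norm].
Qed.

Lemma semigroup_null t u v : 0 <= t -> null_eq nrm u v -> null_eq nrm (T t u) (T t v).
Proof.
move=> t0 uv; have [M _ HM] := semigroup_lipschitz t0.
by rewrite /null_eq; apply/nrm_le0/(le_trans (HM u v)); rewrite (uv : nrm _ = 0) mulr0.
Qed.

Lemma semigroupZ t a u : 0 <= t -> null_eq nrm (T t (a *: u)) (a *: T t u).
Proof.
move=> t0; have := semigroup_linear TS t0 a u (u - u).
rewrite subrr addr0 => h; apply: (null_eq_trans ipP h).
rewrite -[X in null_eq _ _ X]addr0; apply: (null_eqD ipP); first exact: null_eqxx.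
by rewrite -(subrr u); apply: (null_eq_trans ipP (semigroupB u u t0)); rewrite !subrr; exact: null_eqxx.
Qed.

Lemma null_eqN u v : null_eq nrm u v -> null_eq nrm (- u) (- v).
Proof. by move/(null_eqZ ipP (-1)); rewrite !scaleN1r. Qed.

Lemma generator_uniq u f g : G u f -> G u g -> null_eq nrm f g.
Proof. by move=> /TG hf /TG hg; exact: (nrm_cvg_unique ipP hf hg). Qed.

Lemma generator_null u u' f f' : null_eq nrm u u' -> null_eq nrm f f' -> G u f -> G u' f'.
Proof.
move=> uu ff /TG h; apply/TG.
apply: (ger0_cvgr0_le h) => [t|]; first exact: nrm_ge0.
exists 1 => //= t _ t0; apply: (nrm_eq_le ipP).
apply: (null_eqD ipP); last exact/null_eqN/(null_eq_sym ipP).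
apply: (null_eqZ ipP); apply: (null_eqD ipP); last exact/null_eqN/(null_eq_sym ipP).
by apply: semigroup_null; [exact: ltW|exact/(null_eq_sym ipP)].
Qed.

Lemma generator_linear a u v f g : G u f -> G v g -> G (a *: u + v) (a *: f + g).
Proof.
move=> /TG hu /TG hv; apply/TG.
have h : nrm ((a *: quot t u + quot t v) - (a *: f + g)) @[t --> 0^'+] --> (0 : R).
  by apply: (cvg_nrmD ipP) => //; exact: (cvg_nrmZ ipP).
apply: (ger0_cvgr0_le h) => [t|]; first exact: nrm_ge0.
exists 1 => //= t _ t0; apply: (nrm_eq_le ipP).
apply: (null_eqD ipP); last exact: null_eqxx.
rewrite scalerA (mulrC a) -scalerA -scalerDr.
apply: (null_eqZ ipP); rewrite scalerBr addrACA -opprD.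
by apply: (null_eqD ipP); [exact: (semigroup_linear TS (ltW t0))|exact: null_eqxx].
Qed.

(** [T t] commutes with the difference quotient up to a null vector and is Lipschitz, so it carries
    the limit along. *)
Lemma generator_semigroup t u f : 0 <= t -> G u f -> G (T t u) (T t f).
Proof.
move=> t0 /TG hu; apply/TG.
have [M M0 HM] := semigroup_lipschitz t0.
have h : M * nrm (quot h u - f) @[h --> 0^'+] --> (0 : R).
  by rewrite -[X in _ --> X](mulr0 M); apply: cvgM => //; exact: cvg_cst.
apply: (ger0_cvgr0_le h) => [s|]; first exact: nrm_ge0.
exists 1 => //= s _ s0; apply: le_trans (HM _ _); apply: (nrm_eq_le ipP).
apply: (null_eqD ipP); last exact: null_eqxx.
apply/(null_eq_sym ipP)/(null_eq_trans ipP (semigroupZ _ _ t0))/(null_eqZ ipP).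
apply: (null_eq_trans ipP (semigroupB _ _ t0)); apply: (null_eqD ipP); last exact: null_eqxx.
apply: (null_eq_trans ipP (null_eq_sym ipP (semigroupD TS t0 (ltW s0) u))).
by rewrite addrC; exact: (semigroupD TS (ltW s0) t0 u).
Qed.

Lemma semigroup_right_continuous t u : 0 <= t ->
  nrm (T (t + h) u - T t u) @[h --> 0^'+] --> (0 : R).
Proof. by move=> t0; exact: (cvg_comp _ _ (at_right_within t0) (semigroup_continuous TS u t0)). Qed.

Definition orbit_energy u t := ip (T t u) (T t u).

Lemma orbit_energy_continuous u t : 0 <= t ->
  orbit_energy u s @[s --> within [set s : R | 0 <= s] (nbhs t)] --> orbit_energy u t.
Proof. by move=> t0; apply: (cvg_ip ipP); exact: (semigroup_continuous TS u t0). Qed.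

Lemma orbit_energy_rcontinuous u t : 0 <= t ->
  orbit_energy u (t + h) @[h --> 0^'+] --> orbit_energy u t.
Proof. by move=> t0; exact: (cvg_comp _ _ (at_right_within t0) (@orbit_energy_continuous u t t0)). Qed.

(** A difference of squared norms is the product of the difference and the sum; the difference
    quotient converges by the generator, the sum by strong continuity. *)
Lemma orbit_energy_rderive u f t : 0 <= t -> G u f ->
  rderive (orbit_energy u) t (2 * ip (T t u) (T t f)).
Proof.
move=> t0 /(generator_semigroup t0)/TG hu.
have h1 : nrm (h^-1 *: (T (t + h) u - T t u) - T t f) @[h --> 0^'+] --> (0 : R).
  apply: (ger0_cvgr0_le hu) => [s|]; first exact: nrm_ge0.
  exists 1 => //= s _ s0; apply: (nrm_eq_le ipP).
  apply: (null_eqD ipP); last exact: null_eqxx.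
  apply: (null_eqZ ipP); apply: (null_eqD ipP); last exact: null_eqxx.
  by rewrite addrC; exact: (semigroupD TS (ltW s0) t0 u).
have h2 : nrm (T (t + h) u + T t u - (T t u + T t u)) @[h --> 0^'+] --> (0 : R).
  apply: (cvg_nrmD ipP); first exact: semigroup_right_continuous.
  by under eq_fun do rewrite subrr (nrm0 ipP); exact: cvg_cst.
have h3 : ip (h^-1 *: (T (t + h) u - T t u)) (T (t + h) u + T t u) @[h --> 0^'+] -->
    ip (T t f) (T t u + T t u) by exact: (cvg_ip ipP).
have -> : 2 * ip (T t u) (T t f) = ip (T t f) (T t u + T t u).
  by rewrite (ipDr ipP) (ipC ipP (T t f)); ring.
apply: cvg_trans h3; apply: near_eq_cvg; apply: nearW => h /=.
rewrite (ipZl ipP) /orbit_energy; congr (_ * _).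
by rewrite (ipBl ipP) !(ipDr ipP) (ipC ipP (T t u) (T (t + h) u)); ring.
Qed.

(** Along the orbit of an eigenvector the energy times [exp(-2 l t)] has derivative zero, so the
    norm is multiplied by at least [e^l] in unit time, which the bound [M] forbids unless [u] is
    null. *)
Lemma generator_eigen u l M : G u (l *: u) ->
  (forall v, nrm (T 1 v) <= M * nrm v) -> M < expR l -> nrm u = 0.
Proof.
move=> Gu TM Ml.
(* The minus sign makes the monotonicity lemma, which yields upper bounds, give a lower bound on the
   energy at time 1. *)
pose c := - 2 * l; pose e t := - expR (c * t).
have ed t : is_derive t 1 e (- (expR (c * t) * c)).
  apply: is_deriveN; apply: (@is_derive1_comp _ expR ( *%R c)).
  have h := @is_deriveZ R R R id c t 1 1 (is_derive_id t 1).
  by rewrite (_ : c *: 1 = c) in h; last by rewrite /GRing.scale/= mulr1.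
have ec : continuous e.
  by move=> t; apply/differentiable_continuous/derivable1_diffP; case: (ed t).
have F10 : e 1 * orbit_energy u 1 <= e 0 * orbit_energy u 0.
  apply: (@right_derivative_le0 R (fun t => e t * orbit_energy u t) (fun=> 0)) => // t t0.
    apply: cvgM; last exact: orbit_energy_continuous.
    exact: cvg_within_filter (ec t).
  have := rderiveM (@orbit_energy_rcontinuous u t t0) (derivable_rderive (ed t)) (orbit_energy_rderive t0 Gu).
  rewrite (ipC ipP) (ip_eql ipP _ (semigroupZ l u t0)) (ipZl ipP) /e /c -/(orbit_energy u t).
  by move=> h; rewrite [X in _ --> X](_ : _ = - (expR (- 2 * l * t) * (- 2 * l)) * orbit_energy u t +
    - expR (- 2 * l * t) * (2 * (l * orbit_energy u t))) //; ring.
have E0 : orbit_energy u 0 = ip u u.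
  rewrite /orbit_energy (ip_eql ipP _ (semigroup0 TS u)) (ipC ipP).
  by rewrite (ip_eql ipP _ (semigroup0 TS u)).
have {F10} h : expR l * nrm u <= nrm (T 1 u).
  rewrite -(@ler_pXn2r _ 2)// ?nnegrE ?mulr_ge0 ?nrm_ge0 ?expR_ge0//.
  rewrite exprMn !(sqr_nrm ipP) -expRM_natl -E0 -/(orbit_energy u 1).
  move: F10; rewrite /e mulr0 expR0 mulr1 !mulNr mul1r lerN2 => h.
  have := ler_wpM2l (expR_ge0 (2 * l)) h; rewrite mulrA -expRD /c.
  by rewrite mulNr subrr expR0 mul1r.
apply/eqP; rewrite eq_le nrm_ge0 andbT leNgt; apply/negP => u0.
have := le_trans h (TM u); rewrite ler_pM2r// leNgt Ml//.
Qed.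

End Generator.

(** * Polynomial decay under a weak dissipation *)

(** Each induction step restarts the orbit at [t / 2]: the factor [(2 / t)^m] leaves the power of 2,
    and [C] is the price of one use of [decay1]. *)
Fixpoint decay_const {R : realType} (C : R) (m : nat) : R :=
  if m is m'.+1 then 2 ^+ m * (C * decay_const C m') else 1.

Lemma decay_const_gt0 {R : realType} (C : R) m : 0 < C -> 0 < decay_const C m.
Proof. by move=> C0; elim: m => //= m IH; rewrite !mulr_gt0// exprn_gt0. Qed.

Section Decay.
Context {R : realType} {X : lmodType R} (ip : X -> X -> R) (ipP : is_ip ip).
Local Notation nrm := (ipnorm ip).
Variables (T : R -> X -> X) (G : X -> X -> Prop) (q : X -> R) (l C : R).
(** [q] is the dissipated power. It is not asked to control the energy of [u] alone; by
    [G_observable] the dissipations of [u] and of its derivative [f] together do. In [G_surjective],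
    [G u (l *: u - x)] means that [u] is the resolvent of [x]. *)
Hypotheses (ipcomplete : ip_complete ip)
  (TS : C0_semigroup nrm T) (TG : generates nrm G T)
  (q_ge0 : forall u, 0 <= q u)
  (G_dissipative : forall u f, G u f -> ip u f <= - q u)
  (G_observable : forall u f, G u f -> ip u u <= C * (q u + q f))
  (l_gt0 : 0 < l) (C_gt0 : 0 < C)
  (G_surjective : forall x, exists u, G u (l *: u - x)).
Implicit Types (u v f g : X) (t h : R).

Lemma generator_ip_le0 u f : G u f -> ip u f <= 0.
Proof. by move/G_dissipative => h; apply: (le_trans h); rewrite oppr_le0. Qed.

Lemma generator0 : G 0 0.
Proof.
have [u Gu] := G_surjective 0.
by have := generator_linear ipP TS TG (-1) Gu Gu; rewrite !scaleN1r !addNr.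
Qed.

(** Pairing [(l - A) u = x] with [u] and using dissipativity gives [l |u|^2 <= <u, x>]. *)
Lemma resolvent_bound u x : G u (l *: u - x) -> l * nrm u <= nrm x.
Proof.
move/generator_ip_le0; rewrite (ipBr ipP) (ipZr ipP) -(sqr_nrm ipP) subr_le0 => h.
have [->|u0] := eqVneq (nrm u) 0; first by rewrite mulr0 nrm_ge0.
have {}u0 : 0 < nrm u by rewrite lt_neqAle eq_sym u0 nrm_ge0.
rewrite -(ler_pM2r u0) -mulrA -expr2 (le_trans h)// mulrC.
by apply: le_trans (ip_le ipP _ _); exact: ler_norm.
Qed.

(* A vector orthogonal to the domain is tested against its own resolvent. *)
Lemma generator_dense x e : 0 < e -> exists u f, G u f /\ nrm (x - u) < e.
Proof.
move=> e0.
have [||w wP|u [f Guf] uP] := orthogonal_null_dense ipP (V := fun u => exists f, G u f) ipcomplete _ _ _ x e0.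
- by exists 0; exact: generator0.
- by move=> a u v [f Gf] [g Gg]; exists (a *: f + g); exact: (generator_linear ipP TS TG).
- have [u Gu] := G_surjective w.
  have wu : ip w u = 0 by apply: wP; exists (l *: u - w).
  have u0 : nrm u = 0.
    have := generator_ip_le0 Gu; rewrite (ipBr ipP) (ipZr ipP) (ipC ipP u w) wu subr0 -(sqr_nrm ipP).
    rewrite pmulr_rle0// => h; apply/eqP; rewrite -sqrf_eq0; apply/eqP/le_anti.
    by rewrite h sqr_ge0.
  (* As [u] is null, the generator sends 0 to [l u - w]; single-valuedness makes this vector null,
     hence [w] too. *)
  have G0 : G 0 (l *: u - w).
    by apply: (generator_null ipP TS TG _ _ Gu); rewrite /null_eq ?subr0// subrr (nrm0 ipP).
  have := generator_uniq ipP TG G0 generator0; rewrite /null_eq subr0 => h.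
  have -> : w = l *: u - (l *: u - w) by rewrite opprB addrCA subrr addr0.
  apply: nrm_le0; apply: le_trans (ler_nrmD ipP _ _) _.
  by rewrite (nrmN ipP) h (nrmZ ipP) u0 mulr0 addr0.
- by exists u, f.
Qed.

Local Notation E := (orbit_energy ip T).

Lemma orbit_energy0 u : E u 0 = ip u u.
Proof.
rewrite /orbit_energy (ip_eql ipP _ (semigroup0 TS u)) (ipC ipP).
by rewrite (ip_eql ipP _ (semigroup0 TS u)).
Qed.

Lemma contraction_domain u f t : G u f -> 0 <= t -> nrm (T t u) <= nrm u.
Proof.
move=> Gu t0; rewrite -(@ler_pXn2r _ 2)// ?nnegrE ?nrm_ge0// !(sqr_nrm ipP).
rewrite -(orbit_energy0 u).
apply: (@right_derivative_le0 R (E u) (fun t => 2 * ip (T t u) (T t f))) => // s s0.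
- exact: orbit_energy_continuous.
- exact: (orbit_energy_rderive ipP TS TG).
- by rewrite pmulr_rle0//; apply: generator_ip_le0; exact: (generator_semigroup ipP TS TG).
Qed.

Lemma contraction u t : 0 <= t -> nrm (T t u) <= nrm u.
Proof.
move=> t0; have [M M0 HM] := semigroup_lipschitz ipP TS t0.
apply/ler_addgt0Pr => e e0.
(* The error is paid [M] times when replacing [T t u] by [T t v] and once more when replacing
   [nrm v] by [nrm u]. *)
have [v [f [Gv uv]]] := generator_dense u (divr_gt0 e0 (ltr_wpDl M0 ltr01 : 0 < M + 1)).
have := contraction_domain Gv t0.
have := HM u v.
have := ler_nrmB ipP (T t u) (T t v) 0; rewrite !subr0.
have := ler_nrmB ipP v u 0; rewrite !subr0 (nrmB ipP v u).
have : nrm (u - v) * (M + 1) < e by rewrite -ltr_pdivlMr// ltr_wpDl.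
move: (nrm (u - v)) => *; lra.
Qed.

Lemma contraction_sub u v t : 0 <= t -> nrm (T t u - T t v) <= nrm (u - v).
Proof. by move=> t0; rewrite -(nrm_eq ipP (semigroupB TS u v t0)); exact: contraction. Qed.

(* The Lyapunov function is [E u + E f + (2 / C) t (E u)]. *)
Lemma decay1_smooth u f g t : G u f -> G f g -> 0 <= t ->
  t * E u t <= C / 2 * (ip u u + ip f f).
Proof.
(* With this [c], observability bounds the new term [c * E u s] by [2 (q u + q f)], exactly the rate
   at which the energies of [u] and [f] are known to decrease. *)
move=> Gu Gf t0; pose c := 2 / C.
have c0 : 0 < c by rewrite divr_gt0.
pose L s := E u s + E f s + c * s * E u s.
suff : L t <= L 0.
  rewrite /L !orbit_energy0 mulr0 mul0r addr0 => h.
  have h1 : c * t * E u t <= ip u u + ip f f.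
    apply: le_trans h; rewrite lerDr addr_ge0//; exact: (ip_ge0 ipP).
  have -> : t * E u t = C / 2 * (c * t * E u t) by rewrite /c; field; rewrite gt_eqF.
  by rewrite ler_pM2l// divr_gt0.
pose d s := 2 * ip (T s u) (T s f) + 2 * ip (T s f) (T s g) +
  (c * E u s + c * s * (2 * ip (T s u) (T s f))).
have cs s : rderive (fun s => c * s) s c.
  have h : s + h @[h --> 0^'+] --> s.
    rewrite -[X in _ --> X]addr0.
    by apply: cvgD; [exact: cvg_cst|apply: cvg_at_right_filter; exact: cvg_id].
  have := @rderiveM R (fun=> c) id s 0 1 h (rderive_cst c s) (rderive_id s).
  by rewrite mul0r mulr1 add0r.
apply: (@right_derivative_le0 R L d) => // s s0.
- apply: cvgD; first by apply: cvgD; exact: orbit_energy_continuous.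
  apply: cvgM; last exact: orbit_energy_continuous.
  by apply: cvgM; [exact: cvg_cst|apply: cvg_within_filter; exact: cvg_id].
- have Eu := orbit_energy_rderive ipP TS TG s0 Gu.
  have Ef := orbit_energy_rderive ipP TS TG s0 Gf.
  exact: (rderiveD (rderiveD Eu Ef)
    (rderiveM (orbit_energy_rcontinuous ipP TS (u := u) s0) (cs s) Eu)).
- have Gus := generator_semigroup ipP TS TG s0 Gu.
  have Gfs := generator_semigroup ipP TS TG s0 Gf.
  have h1 := G_dissipative Gus; have h2 := G_dissipative Gfs.
  have h3 : c * E u s <= 2 * (q (T s u) + q (T s f)).
    rewrite /c mulrAC ler_pdivrMr// -mulrA ler_pM2l// mulrC.
    exact: G_observable.
  have h4 : c * s * (2 * ip (T s u) (T s f)) <= 0.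
    apply: mulr_ge0_le0; first by rewrite mulr_ge0// ltW.
    by apply: mulr_ge0_le0 => //; exact: generator_ip_le0.
  by rewrite /d; lra.
Qed.

(** The bound of [decay1_smooth] does not involve [g], so it passes to limits in [u] and [f]. To
    approximate them, take [v] in the domain close to [l u - f] and let [w] be its resolvent: [w]
    and its image [l w - v] both lie in the domain, and they are close to [u] and [f] by the
    resolvent bound. *)
Lemma decay1 u f t : G u f -> 0 <= t -> t * E u t <= C / 2 * (ip u u + ip f f).
Proof.
move=> Gu t0.
have /choice[s sP] : forall n, exists p : X * X * X,
    [/\ G p.1.1 p.1.2, G p.1.2 p.2, nrm (p.1.1 - u) <= l^-1 * harmonic n
     & nrm (p.1.2 - f) <= 2 * harmonic n].
  move=> n; have [v [g [Gv hv]]] := generator_dense (l *: u - f) (harmonic_gt0 n : 0 < harmonic n :> R).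
  have [w Gw] := G_surjective v.
  exists (w, l *: w - v, l *: (l *: w - v) - g) => /=.
  have dE : l *: w - v - f = l *: (w - u) - (v - (l *: u - f)).
    by rewrite scalerBr opprB -[l *: u - f - v]addrA [RHS]addrA subrK [- f - v]addrC addrA.
  have Gwu : G (w - u) (l *: (w - u) - (v - (l *: u - f))).
    by have := generator_linear ipP TS TG (-1) Gu Gw; rewrite !scaleN1r addrC -dE (addrC (- f)).
  have h : nrm (v - (l *: u - f)) <= harmonic n by rewrite (nrmB ipP) ltW.
  have wu : l * nrm (w - u) <= harmonic n by apply: le_trans (resolvent_bound Gwu) _.
  split => //.
  - have := generator_linear ipP TS TG (- 1) Gv (generator_linear ipP TS TG l Gw generator0).
    by rewrite !scaleN1r !addr0 addrC (addrC (- g)).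
  - by rewrite ler_pdivlMl.
  - rewrite dE; apply: le_trans (ler_nrmD ipP _ _) _; rewrite (nrmN ipP) (nrmZ ipP) gtr0_norm//.
    by rewrite mulr_natl mulr2n lerD.
have cvg_s (v : nat -> X) (x : X) (c : R) : (forall n, nrm (v n - x) <= c * harmonic n) ->
    nrm (v n - x) @[n --> \oo] --> (0 : R).
  move=> vx; have h : c * harmonic n @[n --> \oo] --> (0 : R).
    by rewrite -[X in _ --> X](mulr0 c); apply: cvgM; [exact: cvg_cst|exact: cvg_harmonic].
  by apply: (ger0_cvgr0_le h) => [n|]; [exact: nrm_ge0|exact: nearW].
have su : nrm ((s n).1.1 - u) @[n --> \oo] --> (0 : R).
  by apply: (cvg_s _ _ l^-1) => n; have [] := sP n.
have sf : nrm ((s n).1.2 - f) @[n --> \oo] --> (0 : R).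
  by apply: (cvg_s _ _ 2) => n; have [] := sP n.
have sT : nrm (T t (s n).1.1 - T t u) @[n --> \oo] --> (0 : R).
  apply: (ger0_cvgr0_le su) => [n|]; first exact: nrm_ge0.
  by apply: nearW => n; exact: contraction_sub.
have h1 : t * E (s n).1.1 t @[n --> \oo] --> t * E u t.
  by apply: cvgM; [exact: cvg_cst|exact: (cvg_ip ipP)].
have h2 : C / 2 * (ip (s n).1.1 (s n).1.1 + ip (s n).1.2 (s n).1.2) @[n --> \oo] -->
    C / 2 * (ip u u + ip f f).
  by apply: cvgM; [exact: cvg_cst|apply: cvgD; apply: (cvg_ip ipP)].
apply: (ler_cvg_to h1 h2); apply: nearW => n.
by have [Gu1 Gf1 _ _] := sP n; exact: (decay1_smooth Gu1 Gf1 t0).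
Qed.

Lemma orbit_energy_le u t : 0 <= t -> E u t <= ip u u.
Proof.
move=> t0; rewrite /orbit_energy -!(sqr_nrm ipP).
by rewrite ler_pXn2r ?nnegrE ?nrm_ge0//; exact: contraction.
Qed.

(** [us] lists a vector and its successive images. [decay1] is applied on the second half of
    [[0, t]]; the energies of [us 0] and [us 1] at [t / 2] are bounded by the induction hypothesis
    for the chain and for its shift, which is why the chain is generalised. *)
Theorem orbit_energy_decay m (us : nat -> X) :
  (forall k, (k < m)%N -> G (us k) (us k.+1)) -> forall t, 0 < t ->
  E (us 0%N) t <= decay_const C m * (\sum_(k < m.+1) ip (us k) (us k)) * t ^- m.
Proof.
elim: m us => [|m IH] us usP t t0.
  rewrite big_ord_recl big_ord0 addr0 mul1r expr0 invr1 mulr1.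
  exact/orbit_energy_le/ltW.
pose K := decay_const C m; have K0 : 0 < K by exact: decay_const_gt0.
rewrite -/K in IH; rewrite [decay_const _ _]/= -/K.
have s0 : 0 < t / 2 by rewrite divr_gt0.
have Gu := generator_semigroup ipP TS TG (ltW s0) (usP 0%N isT).
have := decay1 Gu (ltW s0).
have -> : E (T (t / 2) (us 0%N)) (t / 2) = E (us 0%N) t.
  have h := semigroupD TS (ltW s0) (ltW s0) (us 0%N).
  rewrite -splitr in h; rewrite /orbit_energy -!(sqr_nrm ipP); congr (_ ^+ 2).
  exact/esym/(nrm_eq ipP).
rewrite -!/(E _ _) => h.
have S0 := IH us (fun k km => usP k (ltnW km)) _ s0.
have S1 := IH (us \o S) (fun k km => usP k.+1 km) _ s0.
set Sm := \sum_(k < m.+2) _.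
have L0 : \sum_(k < m.+1) ip (us k) (us k) <= Sm.
  by rewrite /Sm [leRHS]big_ord_recr/= lerDl (ip_ge0 ipP).
have L1 : \sum_(k < m.+1) ip ((us \o S) k) ((us \o S) k) <= Sm.
  by rewrite /Sm [leRHS]big_ord_recl/= lerDr (ip_ge0 ipP).
have tm : 0 < (t / 2) ^- m by rewrite invr_gt0 exprn_gt0.
have {}S0 : E (us 0%N) (t / 2) <= K * Sm * (t / 2) ^- m.
  by apply: le_trans S0 _; rewrite ler_pM2r// ler_pM2l.
have {}S1 : E (us 1%N) (t / 2) <= K * Sm * (t / 2) ^- m.
  by apply: le_trans S1 _; rewrite ler_pM2r// ler_pM2l.
have h2 : t / 2 * E (us 0%N) t <= C * (K * Sm * (t / 2) ^- m).
  apply: le_trans h _; rewrite -mulrA ler_pM2l//.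
  by rewrite ler_pdivrMl// mulr_natl mulr2n lerD.
rewrite -ler_pdivlMl// in h2.
apply: (le_trans h2); rewrite le_eqVlt; apply/orP; left; apply/eqP.
rewrite !exprS !expr_div_n; field.
by rewrite !gt_eqF ?exprn_gt0.
Qed.

Theorem orbit_energy_cvg0 u : E u t @[t --> +oo] --> (0 : R).
Proof.
pose K := decay_const C 1; have K0 : 0 < K by exact: decay_const_gt0.
apply/cvgrPdist_lt => e e0.
(* Two errors of norm [sqrt (e / 4)], one from density and one from the decay of [v], add up to
   [sqrt e]. *)
have d0 : 0 < e / 4 by rewrite divr_gt0.
have sd0 : 0 < Num.sqrt (e / 4) by rewrite sqrtr_gt0.
have [v [f [Gv uv]]] := generator_dense u sd0.
pose us k := if k is 0%N then v else f.
have usP k : (k < 1)%N -> G (us k) (us k.+1) by case: k.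
have HK t := orbit_energy_decay usP (t := t).
move: HK; rewrite -/K; set S := \sum_(k < 2) _ => HK.
have S0 : 0 <= S by apply: sumr_ge0 => i _; exact: (ip_ge0 ipP).
exists (K * S / (e / 4)); split; first exact: num_real.
move=> t; rewrite ltr_pdivrMr// => tK.
have t0 : 0 < t by rewrite -(pmulr_lgt0 _ d0) (le_lt_trans _ tK)// mulr_ge0// ltW.
have := HK t t0; rewrite /us/= expr1 ler_pdivlMr// => Ev.
have {}Ev : E v t <= e / 4 by rewrite -(ler_pM2r t0) (le_trans Ev)// [leRHS]mulrC ltW.
rewrite sub0r normrN ger0_norm; last exact: (ip_ge0 ipP).
have : nrm (T t u) <= nrm (T t v) + nrm (u - v).
  apply: le_trans (lerD (lexx _) (contraction_sub u v (ltW t0))).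
  by rewrite addrC; have := ler_nrmB ipP (T t u) (T t v) 0; rewrite !subr0.
have : nrm (T t v) <= Num.sqrt (e / 4) by rewrite /ipnorm ler_sqrt// ltW.
move=> h1 h2; have h3 : nrm (T t u) < 2 * Num.sqrt (e / 4) by lra.
rewrite /orbit_energy -(sqr_nrm ipP).
have -> : e = (2 * Num.sqrt (e / 4)) ^+ 2 by rewrite exprMn sqr_sqrtr ?ltW//; field.
by rewrite ltr_pXn2r// ?nnegrE ?nrm_ge0// mulr_ge0// ltW.
Qed.

End Decay.

(** * Generators given by Green's identity *)

(* The generator is the adjoint of a core [C]: it is given by Green's identity
   against the elements of [C].  An orthogonal to the range of [l - C] becomes,
   by the time reversal [J], an eigenvector of the generator for the eigenvalue
   [l], which is excluded by the growth bound of the semigroup when [l] is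
   large.  Hence [C] is dense in the generator for the graph norm. *)
Section GreenIdentity.
Context {R : realType} {X : lmodType R} (ip D : X -> X -> R).
Local Notation nrm := (ipnorm ip).
Variables (T : R -> X -> X) (G C : X -> X -> Prop) (J : X -> X) (c : R).
Hypotheses (ipP : is_ip ip) (DP : is_ip D) (ipcomplete : ip_complete ip)
  (D_le : forall u, D u u <= c * ip u u)
  (TS : C0_semigroup nrm T) (TG : generates nrm G T)
  (G_adjoint : forall u f, G u f <->
     forall v g, C v g -> ip f v + ip u g = - (2 * D u v))
  (C_sub : forall u f, C u f -> G u f)
  (J_adjoint : forall u v, ip (J u) v = ip u (J v))
  (D_J : forall u v, D (J u) v = D u (J v))
  (J_norm : forall u, nrm (J u) = nrm u)
  (C_J : forall v g, C v g -> exists2 s : R, J v = s *: v &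
     forall w, ip w (s *: g) + ip (J w) g = - (2 * D w (J v))).
Implicit Types (u v w f g : X).

(** Green's identity against the whole generator instead of the core. It holds for core elements by
    symmetry, is closed under limits, and on the diagonal it is the energy identity; the aim is to
    obtain it for every pair of [G]. *)
Let green u f := forall v g, G v g -> ip f v + ip u g = - (2 * D u v).

Lemma cvg_D (s : nat -> X) u v : nrm (s n - u) @[n --> \oo] --> (0 : R) ->
  D (s n) v @[n --> \oo] --> D u v.
Proof.
move=> su; apply: (cvg_ip DP); last by under eq_fun do rewrite subrr (nrm0 DP); exact: cvg_cst.
have h : Num.sqrt `|c| * nrm (s n - u) @[n --> \oo] --> (0 : R).
  by rewrite -[X in _ --> X](mulr0 (Num.sqrt `|c|)); apply: cvgM => //; exact: cvg_cst.
apply: (ger0_cvgr0_le h) => [n|]; first exact: nrm_ge0.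
apply: nearW => n; rewrite /ipnorm -sqrtrM//; apply: ler_wsqrtr.
apply: (le_trans (D_le _)); apply: ler_wpM2r; first exact: (ip_ge0 ipP).
exact: ler_norm.
Qed.

Lemma core_green u f : C u f -> green u f.
Proof.
by move=> Cuf v g /G_adjoint /(_ _ _ Cuf); rewrite (ipC DP) !(ipC ipP u) !(ipC ipP f) addrC.
Qed.

Lemma graph_closed (us fs : nat -> X) u f : (forall n, G (us n) (fs n)) ->
  nrm (us n - u) @[n --> \oo] --> (0 : R) -> nrm (fs n - f) @[n --> \oo] --> (0 : R) ->
  G u f.
Proof.
move=> Gn un fn; apply/G_adjoint => v g Cvg.
have ip_cst (s : nat -> X) x y : nrm (s n - x) @[n --> \oo] --> (0 : R) ->
    ip (s n) y @[n --> \oo] --> ip x y.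
  move=> sx; apply: (cvg_ip ipP) => //.
  by under eq_fun do rewrite subrr (nrm0 ipP); exact: cvg_cst.
have h1 : ip (fs n) v + ip (us n) g @[n --> \oo] --> ip f v + ip u g.
  by apply: cvgD; exact: ip_cst.
have h2 : - (2 * D (us n) v) @[n --> \oo] --> - (2 * D u v).
  by apply: cvgN; apply: cvgM; [exact: cvg_cst|exact: cvg_D].
have E : (fun n => ip (fs n) v + ip (us n) g) = (fun n => - (2 * D (us n) v)).
  by apply/funext => n; exact: (G_adjoint (us n) (fs n)).1.
by rewrite E in h1; exact: (@cvg_unique R (@norm_hausdorff R R) _ _ _ _ h1 h2).
Qed.

Lemma green_linear (a : R) u v f g : green u f -> green v g -> green (a *: u + v) (a *: f + g).
Proof.
move=> hu hv w k Gwk; have {}hu := hu _ _ Gwk; have {}hv := hv _ _ Gwk.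
rewrite !(ipDl ipP) !(ipZl ipP) (ipDl DP) (ipZl DP).
by rewrite addrACA -mulrDr hu hv; ring.
Qed.

Let G0 : G 0 0.
Proof. by apply/G_adjoint => v g _; rewrite !(ip0l ipP) (ip0l DP) mulr0 oppr0 addr0. Qed.

Variable l : R.
Hypotheses (l_gt0 : 0 < l) (l_large : exists2 M, forall v, nrm (T 1 v) <= M * nrm v & M < expR l).

Lemma eigen_null u : G u (l *: u) -> nrm u = 0.
Proof. by have [M TM Ml] := l_large => Gu; exact: (generator_eigen ipP TS TG Gu TM Ml). Qed.

Lemma core_range_orthogonal w :
  (forall u f, G u f -> green u f -> ip w (l *: u - f) = 0) -> nrm w = 0.
Proof.
move=> hw; rewrite -J_norm; apply: eigen_null; apply/G_adjoint => v g Cvg.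
(* As [J v = s v], orthogonality tested at [s v] reads [l <w, J v> = <w, s g>], and [sg] turns this
   into Green's identity for [J w] and [l J w]. *)
have [s Jv sg] := C_J Cvg.
have := hw (s *: v + 0) (s *: g + 0) (generator_linear ipP TS TG s (C_sub Cvg) G0)
  (green_linear s (core_green Cvg) _).
rewrite !addr0 (ipBr ipP) (ipZr ipP) -Jv => h.
rewrite (ipZl ipP) !J_adjoint D_J.
have {}h : l * ip w (J v) = ip w (s *: g).
  apply/eqP; rewrite -subr_eq0; apply/eqP; apply: h => u k _.
  by rewrite !(ip0l ipP) (ip0l DP) mulr0 oppr0 addr0.
by rewrite h -J_adjoint sg.
Qed.

Lemma green_diag u f : G u f -> green u f -> ip u f = - D u u.
Proof.
move=> Gu /(_ _ _ Gu); rewrite (ipC ipP f) => h.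
lra.
Qed.

(** The pairs satisfying both [G] and [green] form a linear space containing the core, so by
    [core_range_orthogonal] the range of [l - A] on them is dense. On these pairs
    [l |u| <= |l u - f|], so convergence of the images makes the [us n] Cauchy; the limit is in [G]
    because an adjoint is closed. *)
Lemma green_range x : exists us fs : nat -> X, exists u, [/\ forall n, green (us n) (fs n),
  nrm (us n - u) @[n --> \oo] --> (0 : R), nrm (fs n - (l *: u - x)) @[n --> \oo] --> (0 : R)
  & G u (l *: u - x)].
Proof.
pose V y := exists u f, [/\ G u f, green u f & y = l *: u - f].
have V0 : V 0.
  exists 0, 0; split => //; last by rewrite scaler0 subr0.
  by move=> v g _; rewrite !(ip0l ipP) (ip0l DP) mulr0 oppr0 addr0.
have Vlin a y z : V y -> V z -> V (a *: y + z).
  move=> [u [f [Gu gu ->]]] [v [g [Gv gv ->]]].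
  exists (a *: u + v), (a *: f + g); split.
  - exact: (generator_linear ipP TS TG).
  - exact: green_linear.
  - by rewrite scalerBr [in RHS]scalerDr !scalerA (mulrC a) opprD addrACA.
have Vperp w : (forall v, V v -> ip w v = 0) -> nrm w = 0.
  by move=> wV; apply: core_range_orthogonal => u f Gu gu; apply: wV; exists u, f.
have /choice[p pP] : forall n : nat, exists p : X * X,
    [/\ G p.1 p.2, green p.1 p.2 & nrm (x - (l *: p.1 - p.2)) < harmonic n].
  move=> n; have [y [u [f [Gu gu ->]]] xy] :=
    orthogonal_null_dense ipP ipcomplete V0 Vlin Vperp x (harmonic_gt0 n : 0 < harmonic n :> R).
  by exists (u, f).
have cp : nrm ((l *: (p n).1 - (p n).2) - x) @[n --> \oo] --> (0 : R).
  apply: (ger0_cvgr0_le (@cvg_harmonic R)) => [n|]; first exact: nrm_ge0.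
  by apply: nearW => n; rewrite (nrmB ipP); have [_ _ /ltW] := pP n.
have resolvent u f : G u f -> green u f -> l * nrm u <= nrm (l *: u - f).
  move=> Gu gu; have := green_diag Gu gu.
  have [->|u0] := eqVneq (nrm u) 0; first by rewrite mulr0 nrm_ge0.
  have {}u0 : 0 < nrm u by rewrite lt_neqAle eq_sym u0 nrm_ge0.
  move=> uf; rewrite -(ler_pM2r u0) -mulrA -expr2 (sqr_nrm ipP).
  apply: (@le_trans _ _ (ip (l *: u - f) u)).
    by rewrite (ipBl ipP) (ipZl ipP) (ipC ipP f) uf opprK lerDl (ip_ge0 DP).
  by apply: le_trans (ip_le ipP _ _); exact: ler_norm.
have [e e0|u un] := ipcomplete (s := fun n => (p n).1).
  have le0 : 0 < l * e / 2 by rewrite divr_gt0// mulr_gt0.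
  move/cvgrPdist_lt : cp => /(_ _ le0)[n0 _ n0P].
  exists n0 => n m hn hm; rewrite -(ltr_pM2l l_gt0).
  have [Gn gn _] := pP n; have [Gm gm _] := pP m.
  have Gnm := generator_linear ipP TS TG (-1) Gm Gn.
  have gnm := green_linear (-1) gm gn.
  rewrite !scaleN1r !(addrC (- _)) in Gnm gnm.
  apply: (le_lt_trans (resolvent _ _ Gnm gnm)).
  have := n0P _ hn; have := n0P _ hm; rewrite /= !sub0r !normrN !ger0_norm ?nrm_ge0//.
  move: (p n) (p m) => [a b] [a' b'] /= h1 h2.
  have -> : l *: (a - a') - (b - b') = (l *: a - b) - (l *: a' - b').
    by rewrite scalerBr !opprB addrACA [RHS]addrACA; congr (_ + _); rewrite addrC.
  have := ler_nrmB ipP (l *: a - b) x (l *: a' - b').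
  rewrite (nrmB ipP x); lra.
have fn : nrm ((p n).2 - (l *: u - x)) @[n --> \oo] --> (0 : R).
  have h2 : nrm ((-1 *: (l *: (p n).1 - (p n).2) + l *: (p n).1) - (-1 *: x + l *: u)) @[n --> \oo] --> (0 : R).
    by apply: (cvg_nrmD ipP); exact: (cvg_nrmZ ipP).
  move: h2; rewrite scaleN1r (addrC (- x)).
  by under eq_fun do rewrite scaleN1r opprB addrNK.
exists (fun n => (p n).1), (fun n => (p n).2), u; split => //.
- by move=> n; have [] := pP n.
- apply: (graph_closed (us := fun n => (p n).1) (fs := fun n => (p n).2)) => //.
  by move=> n; have [] := pP n.
Qed.

Lemma generator_range x : exists u, G u (l *: u - x).
Proof. by have [us [fs [u [_ _ _ Gu]]]] := green_range x; exists u. Qed.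

(** Approximating [l u - f] by [green_range] gives a [v] that is a limit of [green] pairs and has
    the same image under [l - A] as [u]. Then [u - v] is an eigenvector for [l], hence null, and [u]
    inherits the identity. *)
Lemma generator_green u f : G u f -> ip u f = - D u u.
Proof.
move=> Gu; apply: (green_diag Gu).
have [us [fs [v [gn un fn Gv]]]] := green_range (l *: u - f).
have Guv : G (u - v) (l *: (u - v)).
  have := generator_linear ipP TS TG (-1) Gv Gu; rewrite !scaleN1r.
  rewrite (addrC (- v)) (_ : - (l *: v - (l *: u - f)) + f = l *: (u - v))//.
  by rewrite opprB addrAC subrK scalerBr.
have uv := eigen_null Guv.
have {}un : nrm (us n - u) @[n --> \oo] --> (0 : R).
  apply: (ger0_cvgr0_le un) => [n|]; first exact: nrm_ge0.
  apply: nearW => n; have := ler_nrmB ipP (us n) v u.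
  by rewrite (nrmB ipP v u) uv addr0.
have {}fn : nrm (fs n - f) @[n --> \oo] --> (0 : R).
  apply: (ger0_cvgr0_le fn) => [n|]; first exact: nrm_ge0.
  apply: nearW => n; have := ler_nrmB ipP (fs n) (l *: v - (l *: u - f)) f.
  have -> : l *: v - (l *: u - f) - f = - l *: (u - v).
    by rewrite opprB -addrA [f - _ - f]addrAC subrr add0r scaleNr scalerBr opprB.
  by rewrite (nrmZ ipP) uv mulr0 addr0.
move=> w k Gw.
have cst x : nrm (x - x) @[n --> \oo] --> (0 : R) by rewrite subrr (nrm0 ipP); exact: cvg_cst.
have h1 : ip (fs n) w + ip (us n) k @[n --> \oo] --> ip f w + ip u k.
  by apply: cvgD; apply: (cvg_ip ipP) => //; exact: cst.
have h2 : - (2 * D (us n) w) @[n --> \oo] --> - (2 * D u w).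
  by apply: cvgN; apply: cvgM; [exact: cvg_cst|exact: cvg_D].
have E : (fun n => ip (fs n) w + ip (us n) k) = (fun n => - (2 * D (us n) w)).
  by apply/funext => n; exact: gn.
by rewrite E in h1; exact: (@cvg_unique R (@norm_hausdorff R R) _ _ _ _ h1 h2).
Qed.

End GreenIdentity.

(** * The Hilbert space of square-integrable functions *)

Section L2.
Context d (T : measurableType d) (R : realType) (mu : {measure set T -> \bar R}).
Local Notation L2 := (LfunType mu (lee1n 2)).
Implicit Types f g : L2.

Definition l2ip f g : R := (\int[mu]_x (f x * g x))%R.

Lemma l2_mul_integrable (f g : T -> R) :
  f \in Lfun mu 2%:E -> g \in Lfun mu 2%:E ->
  mu.-integrable setT (EFin \o (fun x => f x * g x)).
Proof. by move=> hf hg; apply/Lfun1_integrable; exact: Lfun2_mul_Lfun1. Qed.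

Lemma l2ip_is_ip : is_ip l2ip.
Proof.
split.
- by move=> f g; apply: eq_Rintegral => x _; rewrite mulrC.
- move=> a f g h; rewrite /l2ip.
  rewrite (_ : (fun x => _ * h x) = (fun x => a * (f x * h x) + g x * h x)); last first.
    by apply/funext => x; rewrite mulrDl -mulrA.
  have fh := l2_mul_integrable (LfunP f) (LfunP h).
  rewrite RintegralD//; last 2 first.
  + by rewrite (_ : _ \o _ = (fun x => a%:E * (f x * h x)%:E)%E) //; exact: integrableZl.
  + exact: (l2_mul_integrable (LfunP g) (LfunP h)).
  by rewrite RintegralZl.
- by move=> f; apply: Rintegral_ge0 => x _; rewrite -expr2 sqr_ge0.
Qed.

Lemma l2ip_integral f : (l2ip f f)%:E = (\int[mu]_x ((f x) ^+ 2)%:E)%E.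
Proof.
rewrite /l2ip /Rintegral fineK.
  by apply: eq_integral => x _; rewrite expr2.
apply: integrable_fin_num => //.
exact: (l2_mul_integrable (LfunP f) (LfunP f)).
Qed.

Lemma l2norm_sqr f : fine ('N[mu]_2%:E[EFin \o f])%E ^+ 2 = l2ip f f.
Proof.
apply: EFin_inj; rewrite l2ip_integral.
rewrite -powR_mulrn ?fine_ge0 ?Lnorm_ge0// -poweR_EFin.
rewrite (finite_norm_fine f) powR_Lnorm//.
apply: eq_integral => x _ /=.
by rewrite powR_mulrn// real_normK// num_real.
Qed.

Lemma Lfun2P (f : T -> R) : measurable_fun setT f ->
  (\int[mu]_x ((f x) ^+ 2)%:E < +oo)%E -> f \in Lfun mu 2%:E.
Proof.
move=> mf hf; apply/andP; split; rewrite inE//=.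
rewrite /finite_norm unlock; apply: poweR_lty.
by under eq_integral => x _ do rewrite /= powR_mulrn// real_normK ?num_real//.
Qed.

End L2.

(** * Completeness of the space of square-integrable functions *)

Section RieszFischer.
Context d (T : measurableType d) (R : realType) (mu : {measure set T -> \bar R}).
Local Notation L2 := (LfunType mu (lee1n 2)).

Lemma measurable_fun_limn_einf (f : (T -> \bar R)^nat) :
  (forall n, measurable_fun [set: T] (f n)) ->
  measurable_fun [set: T] (fun x => limn_einf (f ^~ x)).
Proof.
move=> mf.
rewrite (_ : (fun x => _) = (fun x => oppe (limn_esup ((fun n y => oppe (f n y)) ^~ x)))).
  apply: measurableT_comp => //; apply: measurable_fun_limn_esup => n.
  exact: measurableT_comp.
apply/funext => x; rewrite -limn_einfN; congr limn_einf.
by apply/funext => n /=; rewrite oppeK.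
Qed.

Lemma limn_einf_le (u : (\bar R)^nat) (c : \bar R) :
  (\forall n \near \oo, (u n <= c)%E) -> (limn_einf u <= c)%E.
Proof.
move=> uc; rewrite limn_einf_lim; apply: lime_le; first exact: is_cvg_einfs.
near=> n; apply: (@le_trans _ _ (u n)); last by near: n.
by apply: ereal_inf_lbound; exists n => /=.
Unshelve. all: by end_near. Qed.

(* [sum_n 4^n |v_(n+1) - v_n|^2] is integrable, hence finite almost everywhere,
   which forces geometric decay of the increments. *)
Lemma l2_fast_cauchy_ae_cvg (v : nat -> L2) :
  (forall n, 4 ^+ n * l2ip (v n.+1 - v n) (v n.+1 - v n) <= (2 ^ (n + 1))%:R^-1) ->
  \forall x \ae mu, cvgn (fun n => (v n x : R)).
Proof.
move=> vP.
pose h n x : \bar R := (4 ^+ n * (v n.+1 x - v n x) ^+ 2)%:E.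
have h0 n x : (0 <= h n x)%E by rewrite lee_fin mulr_ge0 ?sqr_ge0 ?exprn_ge0.
have mh n : measurable_fun setT (h n).
  apply/measurable_EFinP; apply: measurable_funM => //.
  by apply: measurable_funX; apply: measurable_funB.
pose H x : \bar R := (\sum_(n <oo) h n x)%E.
have mH : measurable_fun setT H by exact: ge0_emeasurable_sum.
have H0 x : (0 <= H x)%E by apply: nneseries_ge0.
have iH : mu.-integrable setT H.
  apply/integrableP; split => //.
  under eq_integral => x _ do rewrite gee0_abs//.
  rewrite /H integral_nneseries//.
  apply: (@le_lt_trans _ _ 1%E); last by rewrite ltry.
  have hn n : (\int[mu]_x h n x = (4 ^+ n * l2ip (v n.+1 - v n) (v n.+1 - v n))%:E)%E.
    rewrite EFinM l2ip_integral -ge0_integralZl//.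
    - by apply/measurable_EFinP; apply: measurable_funX; exact: measurable_funB.
    - by move=> x _; rewrite lee_fin sqr_ge0.
  have g1 : (\sum_(k <oo) ((1 / (2 ^ (k + 0.+1))%:R)%:E : \bar R) = 1%:E)%E.
    apply/cvg_lim => //.
    by have := @cvg_geometric_eseries_half R 1 0; rewrite expr0 divr1.
  rewrite -g1; apply: lee_nneseries => [k _ _|k _]; first exact: integral_ge0.
  by rewrite hn lee_fin div1r.
have := integrable_ae measurableT iH.
apply: filterS => x /(_ I) Hx.
have [r Hr] : exists r, H x = r%:E by exists (fine (H x)); rewrite fineK.
have hr n : 4 ^+ n * (v n.+1 x - v n x) ^+ 2 <= r.
  rewrite -lee_fin -Hr /H.
  apply: le_trans (nneseries_lim_ge n.+1 _) => //.
  by rewrite big_nat_recr//= leeDr// sume_ge0.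
pose u := telescope (fun n => (v n x : R)).
have : cvgn (series u).
  apply: normed_cvg; apply: (@series_le_cvg _ _ (geometric (Num.sqrt r) 2^-1)).
  - by move=> n; exact: normr_ge0.
  - by move=> n; rewrite /geometric/= mulr_ge0// sqrtr_ge0.
  - move=> n; rewrite /geometric/= /u /telescope/=.
    have -> : 2^-1 ^+ n = Num.sqrt (4 ^- n) :> R.
      have -> : 4 ^- n = (2^-1 ^+ n) ^+ 2 :> R.
        by rewrite -exprVn -exprM mulnC exprM; congr (_ ^+ n); field.
      by rewrite sqrtr_sqr ger0_norm// exprn_ge0.
    rewrite -sqrtr_sqr -sqrtrM; last by apply: le_trans (hr 0); rewrite mulr_ge0// sqr_ge0.
    rewrite ler_sqrt//; last first.
      by rewrite mulr_ge0// ?invr_ge0 ?exprn_ge0//; apply: le_trans (hr 0); rewrite mulr_ge0// sqr_ge0.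
    by rewrite ler_pdivlMr ?exprn_gt0// mulrC.
  - by apply: is_cvg_geometric_series; rewrite ger0_norm// invf_lt1// ltr1n.
move=> cu.
rewrite (_ : (fun n => _) = (fun n => v 0 x + series u n)); first by apply: is_cvgD => //; exact: is_cvg_cst.
by apply/funext => n; exact: (eq_sum_telescope (fun n => (v n x : R))).
Qed.

(** A fast Cauchy subsequence converges almost everywhere, and Fatou's lemma along it bounds the
    distance from its limit to every late term of the sequence. *)
Lemma l2_complete : ip_complete (@l2ip _ T R mu).
Proof.
move=> s sC.
pose en n : R := Num.sqrt (4 ^- n * (2 ^ (n + 1))%:R^-1).
have en0 n : 0 < en n by rewrite sqrtr_gt0 mulr_gt0// ?invr_gt0 ?exprn_gt0// ltr0n expn_gt0.
have /choice[N NP] := fun n => sC (en n) (en0 n).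
(* Summing the thresholds puts both [p n] and [p n.+1] beyond [N n], as consecutive differences
   require. *)
pose p n := (\sum_(i < n.+1) N i + n)%N.
have Np n : (N n <= p n)%N by rewrite /p big_ord_recr/= -addnA addnCA leq_addr.
have Np1 n : (N n <= p n.+1)%N by rewrite /p 2!big_ord_recr/= -!addnA addnCA leq_addr.
have np n : (n <= p n)%N by rewrite /p leq_addl.
pose v n := s (p n).
have vP n : 4 ^+ n * l2ip (v n.+1 - v n) (v n.+1 - v n) <= (2 ^ (n + 1))%:R^-1.
  have := NP n _ _ (Np1 n) (Np n).
  rewrite /en /ipnorm ltr_sqrt; last first.
    by rewrite mulr_gt0// ?invr_gt0 ?exprn_gt0// ltr0n expn_gt0.
  by move=> /ltW; rewrite ler_pdivlMl ?exprn_gt0.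
(* The upper limit is defined and measurable everywhere, including where the subsequence
   diverges. *)
pose g x : R := fine (limn_esup (fun n => (v n x)%:E)).
have mg : measurable_fun setT g.
  apply: measurableT_comp => //.
  apply: measurable_fun_limn_esup => n; exact/measurable_EFinP.
have vg : \forall x \ae mu, v n x @[n --> \oo] --> g x.
  have := l2_fast_cauchy_ae_cvg vP; apply: filterS => x cx.
  have : (v n x)%:E @[n --> \oo] --> (limn (fun n => v n x : R))%:E by apply: cvg_EFin => //; exact: nearW.
  by move/cvg_limn_einf_sup => -[_]; rewrite /g => ->.
have close e : 0 < e -> exists n0, forall n, (n0 <= n)%N ->
    (\int[mu]_x ((g x - s n x) ^+ 2)%:E <= (e ^+ 2)%:E)%E.
  move=> e0; have [n0 n0P] := sC e e0; exists n0 => n nn0.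
  pose F m x := ((v m x - s n x) ^+ 2)%:E.
  have mF m : measurable_fun setT (F m).
    by apply/measurable_EFinP; apply: measurable_funX; exact: measurable_funB.
  have F0 m x : (0 <= F m x)%E by rewrite lee_fin sqr_ge0.
  have -> : (\int[mu]_x ((g x - s n x) ^+ 2)%:E = \int[mu]_x limn_einf (F ^~ x))%E.
    apply: ge0_ae_eq_integral => //.
    - by apply/measurable_EFinP; apply: measurable_funX; exact: measurable_funB.
    - exact: measurable_fun_limn_einf.
    - by move=> x _; rewrite lee_fin sqr_ge0.
    - move=> x _; rewrite limn_einf_lim; apply: lime_ge; first exact: is_cvg_einfs.
      by apply: nearW => m; apply: le_ereal_inf_tmp => _ [k _ <-].
    - apply: filterS vg => x vx _.
      have : F m x @[m --> \oo] --> ((g x - s n x) ^+ 2)%:E.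
        apply: cvg_EFin; first exact: nearW.
        have h : v m x - s n x @[m --> \oo] --> g x - s n x by apply: cvgB => //; exact: cvg_cst.
        have hh : (v m x - s n x) * (v m x - s n x) @[m --> \oo] --> (g x - s n x) * (g x - s n x).
          exact: cvgM.
        exact: hh.
      by move/cvg_limn_einf_sup => -[->].
  apply: le_trans (fatou mu measurableT mF (fun n x _ => F0 n x)) _.
  apply: limn_einf_le; exists n0 => // m /= nm.
  have -> : (\int[mu]_x F m x = (l2ip (v m - s n) (v m - s n))%:E)%E by rewrite l2ip_integral.
  rewrite lee_fin -(sqr_nrm (l2ip_is_ip mu)).
  by rewrite ler_pXn2r ?nnegrE ?nrm_ge0 ?ltW// n0P// (leq_trans nm).
have [n1 n1P] := close 1 ltr01.
(* Fatou controls only [g - s n1]; square integrability of [g] follows by adding [s n1] back. *)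
have DL : (fun x => g x - s n1 x) \in Lfun mu 2%:E.
  apply: Lfun2P; first exact: measurable_funB.
  by apply: le_lt_trans (n1P n1 (leqnn _)) _; rewrite ltry.
pose D : L2 := Lfun_Sub _ DL.
exists (D + s n1); apply/cvgrPdist_lt => e e0.
have [n0 n0P] := close _ (divr_gt0 e0 (ltr0Sn R 1)); exists n0 => // n /= nn0.
rewrite sub0r normrN ger0_norm ?nrm_ge0//.
rewrite (nrmB (l2ip_is_ip mu)) -(@ltr_pXn2r _ 2)// ?nnegrE ?nrm_ge0 ?ltW//.
rewrite (sqr_nrm (l2ip_is_ip mu)).
set w := D + s n1 - s n.
suff : ((l2ip w w)%:E <= ((e / 2) ^+ 2)%:E)%E.
  rewrite lee_fin => /le_lt_trans; apply.
  by rewrite ltr_pXn2r ?nnegrE ?divr_ge0 ?ltW// ltr_pdivrMr// ltr_pMr// ltr1n.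
rewrite l2ip_integral; apply: le_trans (n0P n nn0); rewrite le_eqVlt; apply/orP; left; apply/eqP.
apply: eq_integral => x _; congr (_ ^+ 2)%:E.
have -> : w x = g x - s n1 x + s n1 x - s n x by [].
by rewrite subrK.
Qed.

End RieszFischer.

(** * Test functions on the three-dimensional space *)

Section ContinuousMeasurable.
Context {R : realType}.

(** This links the product topology to the product sigma-algebra: an open set is the countable union
    of the rational boxes that it contains. *)
Lemma open_measurable_space (U : set (R * R * R)) :
  open U -> measurable (U : set (Defs.space R)).
Proof.
move=> oU.
pose box (q : (rat * rat * rat) * nat) : set (R * R * R) :=
  ((ball (ratr q.1.1.1 : R) q.2.+1%:R^-1 `*` ball (ratr q.1.1.2 : R) q.2.+1%:R^-1)
     `*` ball (ratr q.1.2 : R) q.2.+1%:R^-1)%classic.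
have -> : U = \bigcup_(q in [set q | box q `<=` U]) box q.
  apply/seteqP; split => [[[x y] z] Up|p [q qU qp]]; last exact: qU.
  have /nbhs_ballP[e /= e0 eU] : nbhs (x, y, z) U by exact: open_nbhs_nbhs.
  (* A box of radius [r] centred within [r] of the point stays within [2 r < e] of it. *)
  have [n ne] : exists n : nat, n.+1%:R^-1 < e / 2.
    exists (Num.truncn (e / 2)^-1); rewrite invf_plt ?posrE ?divr_gt0//.
    exact: truncnS_gt.
  set r := n.+1%:R^-1 in ne.
  have r0 : 0 < r by rewrite /r invr_gt0.
  have rat_close (t : R) : exists q : rat, `|ratr q - t| < r.
    have [q] := @rat_in_itvoo R (t - r) (t + r) (ltac:(lra)).
    by rewrite in_itv/= => /andP[h1 h2]; exists q; rewrite ltr_norml; apply/andP; split; lra.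
  have [q1 h1] := rat_close x; have [q2 h2] := rat_close y; have [q3 h3] := rat_close z.
  exists ((q1, q2, q3), n) => /=; last by split => //=; split.
  move=> [[x' y'] z'] /= [[/= h1' h2'] /= h3'].
  apply: eU; split => /=; first split => /=; rewrite /ball/= -/r in h1' h2' h3' *.
  - have := ler_distD (ratr q1) x x'; rewrite distrC in h1; lra.
  - have := ler_distD (ratr q2) y y'; rewrite distrC in h2; lra.
  - have := ler_distD (ratr q3) z z'; rewrite distrC in h3; lra.
rewrite bigcup_mkcond; apply: countable_bigcupT_measurable => // q.
case: ifPn => // _; apply: measurableX; first apply: measurableX; exact: measurable_ball.
Qed.

Lemma continuous_measurable_space (f : R * R * R -> R) :
  continuous f -> measurable_fun setT (f : Defs.space R -> R).
Proof.
move=> /continuousP cf; apply: (measurability _ (RGenOpens.measurableE R)).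
move=> _ [_ [a [b ->] <-]]; rewrite setTI.
by apply: open_measurable_space; apply/cf/interval_open.
Qed.

End ContinuousMeasurable.

Section CompactSupport.
Context {R : realType}.
Implicit Types (F G : R * R * R -> R) (K M : R).

Lemma bounded_support_integrable d (T : measurableType d) (mu : {measure set T -> \bar R})
    (f : T -> R) (A : set T) M : measurable A -> (mu A < +oo)%E ->
  measurable_fun setT f -> (forall x, `|f x| <= M) -> (forall x, ~ A x -> f x = 0) ->
  mu.-integrable setT (EFin \o f).
Proof.
move=> mA Aoo mf fM fA.
have -> : EFin \o f = (EFin \o f) \_ A.
  apply/funext => x; rewrite patchE; case: ifPn => // /negP xA /=.
  by rewrite fA// => Ax; apply: xA; rewrite inE.
apply/integrable_restrict => //; rewrite setTI.
apply: measurable_bounded_integrable => //; first exact: measurable_funTS.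
exists M; split; first exact: num_real.
by move=> N MN x _ /=; exact: le_trans (fM x) (ltW MN).
Qed.

Definition compactly_supported F :=
  continuous F /\ compact (closure [set x | F x != 0]).

Lemma compactly_supported_vanish F : compactly_supported F ->
  exists2 K, 0 < K & forall p, K < `|p| -> F p = 0.
Proof.
move=> [_ /compact_bounded[M [_ hM]]].
exists (`|M| + 1); first by rewrite ltr_wpDl.
move=> p Kp; apply/eqP/negPn/negP => Fp.
have := hM (`|M| + 1) (ltac:(by rewrite (le_lt_trans (ler_norm M))// ltrDl)) p.
have cp : closure [set x | F x != 0] p by apply: subset_closure.
by move=> /(_ cp) /=; rewrite leNgt Kp.
Qed.

Lemma compactly_supported_bounded F : compactly_supported F -> exists M, forall p, `|F p| <= M.
Proof.
move=> [cF kF].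
have /compact_bounded[M [_ hM]] : compact (F @` closure [set x | F x != 0]).
  by apply: continuous_compact => //; exact: continuous_subspaceT.
exists (`|M| + 1) => p.
have [->|Fp] := eqVneq (F p) 0; first by rewrite normr0 addr_ge0.
apply: (hM (`|M| + 1)); first by rewrite (le_lt_trans (ler_norm M))// ltrDl.
by exists p => //; exact: subset_closure.
Qed.

Definition cube K : set (Defs.space R) := ((`[- K, K] `*` `[- K, K]) `*` `[- K, K])%classic.

Lemma cubeN K (p : R * R * R) : ~ cube K p -> K < `|p|.
Proof.
move=> h; rewrite ltNge; apply/negP; rewrite !prod_normE !ge_max => /andP[/andP[h1 h2] h3].
by apply: h; split; first split; rewrite /= in_itv/= -ler_norml.
Qed.

Lemma measurable_cube K : measurable (cube K).
Proof. by apply: measurableX; first apply: measurableX; exact: measurable_itv. Qed.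

Lemma lebesgue_segment_lty (a b : R) : (lebesgue_measure `[a, b] < +oo)%E.
Proof. by rewrite lebesgue_measure_itv/=; case: ifP => _; rewrite ?ltry// -EFinB ltry. Qed.

Lemma leb2_square_lty K : ((@lebesgue_measure R \x @lebesgue_measure R) (`[(- K)%R, K] `*` `[(- K)%R, K]) < +oo)%E.
Proof.
rewrite product_measure1E//; try exact: measurable_itv.
by apply: lte_mul_pinfty => //; [rewrite ge0_fin_numE// lebesgue_segment_lty|exact: lebesgue_segment_lty].
Qed.

Lemma leb3_cube_lty K : (leb3 R (cube K) < +oo)%E.
Proof.
rewrite /leb3/= product_measure1E//; last first.
  by apply: measurableX; exact: measurable_itv.
apply: lte_mul_pinfty => //; last exact: lebesgue_segment_lty.
by rewrite ge0_fin_numE// leb2_square_lty.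
Qed.

Lemma compactly_supported_integrable F : compactly_supported F ->
  (leb3 R).-integrable setT (EFin \o F).
Proof.
move=> kF; have [K K0 FK] := compactly_supported_vanish kF.
have [M FM] := compactly_supported_bounded kF.
apply: (@bounded_support_integrable _ _ _ _ (cube K) M) => //.
- exact: measurable_cube.
- exact: leb3_cube_lty.
- exact: (continuous_measurable_space kF.1).
- by move=> p /cubeN; exact: FK.
Qed.

Lemma compactly_supportedM F G : compactly_supported F -> continuous G ->
  compactly_supported (fun p => F p * G p).
Proof.
move=> [cF kF] cG; split.
  by move=> p; apply: cvgM; [exact: cF|exact: cG].
apply: (subclosed_compact _ kF); first exact: closed_closure.
by apply: closure_subset => p /=; apply: contra_neq => ->; rewrite mul0r.
Qed.

Lemma compactly_supported_Lfun2 F : compactly_supported F -> (F : Defs.space R -> R) \in Lfun (leb3 R) 2%:E.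
Proof.
move=> kF; apply: Lfun2P; first exact: (continuous_measurable_space kF.1).
have /integrableP[_] := compactly_supported_integrable (compactly_supportedM kF kF.1).
apply: le_lt_trans; rewrite le_eqVlt; apply/orP; left; apply/eqP.
by apply: eq_integral => x _; rewrite /= ger0_norm -expr2 ?sqr_ge0.
Qed.

End CompactSupport.

Lemma is_derive_line (R : realType) (V W : normedModType R) (f : V -> W) (p v : V) (s : R) :
  derivable f (p + s *: v) v ->
  is_derive s 1 (fun t : R => f (p + t *: v)) ('D_v f (p + s *: v)).
Proof.
have E : (fun h : R => h^-1 *: (((fun t : R => f (p + t *: v)) \o shift s) (h *: 1) - f (p + s *: v))) =
    (fun h : R => h^-1 *: ((f \o shift (p + s *: v)) (h *: v) - f (p + s *: v))).
  apply/funext => h; congr (_ *: (f _ - _)) => /=.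
  by rewrite /GRing.scale/= mulr1 -/(GRing.scale _ v) scalerDl addrCA.
by move=> df; split; rewrite /derivable /derive E.
Qed.

Section Leb2.
Context (R : realType).

(* Named so that it can carry the sigma-finiteness required by Fubini's theorem,
   which inference does not find on this product. *)
Definition leb2 : set (measurableTypeR R * measurableTypeR R)%type -> \bar R :=
  (@lebesgue_measure R \x @lebesgue_measure R)%E.

HB.instance Definition _ := Measure.copy leb2 (@lebesgue_measure R \x @lebesgue_measure R)%E.

Lemma leb2_sigma_finite : sigma_finite setT leb2.
Proof.
exists (fun n => `[(- n%:R : R), n%:R]%classic `*` `[(- n%:R : R), n%:R]%classic).
  apply/esym; rewrite -subTset => -[x y] _.
  exists (Num.truncn (`|x| + `|y|)).+1 => //.
  have h := truncnS_gt (`|x| + `|y|).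
  by split; rewrite /= in_itv/= -ler_norml; apply: ltW; apply: le_lt_trans h; rewrite ?lerDl ?lerDr.
move=> k; split; last exact: leb2_square_lty.
by apply: measurableX; exact: measurable_itv.
Qed.

HB.instance Definition _ := Measure_isSigmaFinite.Build _ _ _ leb2 leb2_sigma_finite.

End Leb2.

(** * The integral of a compactly supported partial derivative vanishes *)

Section IntegralPartial.
Context {R : realType}.
Implicit Types (F : R * R * R -> R) (K : R).

Lemma integral_derivative_eq0 (g g' : R -> R) K : 0 < K ->
  (forall t : R, is_derive t 1 g (g' t)) -> continuous g' ->
  (forall t : R, K < `|t| -> g t = 0) -> (forall t : R, K < `|t| -> g' t = 0) ->
  (\int[lebesgue_measure]_t (g' t)%:E = 0)%E.
Proof.
move=> K0 dg cg' g0 g'0.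
have gK t : K < t -> g t = 0 by move=> Kt; apply: g0; rewrite (lt_le_trans Kt)// ler_norm.
have cg : continuous g.
  by move=> t; apply/differentiable_continuous/derivable1_diffP; case: (dg t).
transitivity (\int[lebesgue_measure]_(t in `[(- (K + 1))%R, (K + 1)%R]) (g' t)%:E)%E.
  rewrite [RHS]integral_mkcond; apply: eq_integral => t _.
  rewrite patchE; case: ifPn => // /negP h.
  rewrite g'0// ltNge; apply/negP => tK; apply: h; rewrite inE/= in_itv/= -ler_norml.
  by rewrite (le_trans tK)// lerDl.
rewrite (@continuous_FTC2 R g' g).
- by rewrite gK ?ltrDl// g0 ?subee// normrN gtr0_norm ?ltrDl// addr_gt0.
- lra.
- exact: continuous_subspaceT.
- split.
  + by move=> t _; case: (dg t).
  + exact: (cvg_at_right_filter (cg _)).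
  + exact: (cvg_at_left_filter (cg _)).
- by move=> t _; rewrite derive1E; case: (dg t).
Qed.

(** Fubini's theorem with the [i]-th variable innermost, then the fundamental theorem of calculus on
    each line. The nesting of the product measure makes the order of integration differ with [i]. *)
Lemma integral_partial_eq0 (i : 'I_3) F : compactly_supported F ->
  (forall p, derivable F p (basis_vec R i)) -> compactly_supported (partial i F) ->
  (\int[leb3 R]_p (partial i F p)%:E = 0)%E.
Proof.
move=> kF dF kF'.
have [K1 K10 FK1] := compactly_supported_vanish kF.
have [K2 K20 FK2] := compactly_supported_vanish kF'.
have [M FM] := compactly_supported_bounded kF'.
pose K := Num.max K1 K2.
have K0 : 0 < K by rewrite lt_max K10.
have FK p : K < `|p| -> F p = 0.
  by move=> h; apply: FK1; apply: le_lt_trans h; rewrite le_max lexx.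
have F'K p : K < `|p| -> partial i F p = 0.
  by move=> h; apply: FK2; apply: le_lt_trans h; rewrite le_max lexx orbT.
(* The condition on [p] makes [F] vanish far out on the line; in the max norm it holds when the
   [i]-th coordinate of [p] is 0. *)
have line p : (forall t : R, `|t| <= `|p + t *: basis_vec R i|) ->
    (\int[lebesgue_measure]_t (partial i F (p + t *: basis_vec R i))%:E = 0)%E.
  move=> pt; apply: (@integral_derivative_eq0 (fun t => F (p + t *: basis_vec R i))
    (fun t => partial i F (p + t *: basis_vec R i)) K K0).
  - by move=> t; exact: is_derive_line.
  - move=> t; apply: (@continuous_comp _ _ _ (fun t : R => p + t *: basis_vec R i)); last exact: kF'.1.
    by apply: cvgD; [exact: cvg_cst|apply: cvgZr_tmp; exact: cvg_id].
  - by move=> t Kt; apply: FK; apply: lt_le_trans (pt t).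
  - by move=> t Kt; apply: F'K; apply: lt_le_trans (pt t).
have iF : (leb3 R).-integrable setT (fun p : Defs.space R => (partial i F p)%:E).
  exact: compactly_supported_integrable.
have slice (z : R) : (@leb2 R).-integrable setT
    (fun p : R * R => (partial i F (p, z))%:E).
  apply: (@bounded_support_integrable R _ _ (@leb2 R)
    (fun p => partial i F (p, z)) (`[- K, K] `*` `[- K, K])%classic M) => //.
  - by apply: measurableX; exact: measurable_itv.
  - exact: leb2_square_lty.
  - exact: (measurable_fun_pair1 z (continuous_measurable_space kF'.1)).
  - move=> p h; apply: F'K; by apply: (@cubeN _ _ (p, z)) => -[/= /h].
case: i => -[|[|[|//]]] i3 in dF kF' FK2 FM F'K line iF slice *.
- rewrite -[LHS](@integral21_prod_meas1 _ _ _ _ R (@leb2 R) (@lebesgue_measure R) _ iF).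
  apply: integral0_eq => z _; 
  rewrite /fubini_G -[LHS](@integral21_prod_meas1 _ _ _ _ R
    (@lebesgue_measure R) (@lebesgue_measure R) _ (slice z)).
  apply: integral0_eq => y _; rewrite /fubini_G.
  have E (t : R) : (0, y, z) + t *: basis_vec R (Ordinal i3) = (t, y, z).
    by congr (_, _, _); rewrite /= /GRing.scale/= ?mulr1 ?mulr0 ?add0r ?addr0.
  rewrite -[RHS](line (0, y, z)); first by apply: eq_integral => t _; rewrite E.
  by move=> t; rewrite E !prod_normE/= !le_max lexx.
- rewrite -[LHS](@integral21_prod_meas1 _ _ _ _ R (@leb2 R) (@lebesgue_measure R) _ iF).
  apply: integral0_eq => z _; 
  rewrite /fubini_G -[LHS](@integral12_prod_meas1 _ _ _ _ R
    (@lebesgue_measure R) (@lebesgue_measure R) _ (slice z)).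
  apply: integral0_eq => x _; rewrite /fubini_F.
  have E (t : R) : (x, 0, z) + t *: basis_vec R (Ordinal i3) = (x, t, z).
    by congr (_, _, _); rewrite /= /GRing.scale/= ?mulr1 ?mulr0 ?add0r ?addr0.
  rewrite -[RHS](line (x, 0, z)); first by apply: eq_integral => t _; rewrite E.
  by move=> t; rewrite E !prod_normE/= !le_max lexx orbT.
- rewrite -[LHS](@integral12_prod_meas1 _ _ _ _ R (@leb2 R) (@lebesgue_measure R) _ iF).
  apply: integral0_eq => -[x y] _; rewrite /fubini_F.
  have E (t : R) : (x, y, 0) + t *: basis_vec R (Ordinal i3) = (x, y, t).
    by congr (_, _, _); rewrite /= /GRing.scale/= ?mulr1 ?mulr0 ?add0r ?addr0.
  rewrite -[RHS](line (x, y, 0)); first by apply: eq_integral => t _; rewrite E.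
  by move=> t; rewrite E !prod_normE/= !le_max lexx orbT.
Qed.

End IntegralPartial.

(** * Symmetry of mixed second derivatives *)

Section Schwarz.
Context {R : realType} {V : normedModType R}.
Implicit Types (f : V -> R) (p v w : V).

(** The mean value theorem twice, first along [v] for the increment in direction [w], then along [w]
    for the derivative in direction [v]. *)
Lemma second_difference f v w p (h : R) : 0 < h ->
  (forall q, derivable f q v) -> (forall q, derivable ('D_v f) q w) ->
  exists s t, [/\ 0 <= s <= h, 0 <= t <= h &
    f (p + h *: v + h *: w) - f (p + h *: v) - f (p + h *: w) + f p =
    h ^+ 2 * 'D_w ('D_v f) (p + s *: v + t *: w)].
Proof.
move=> h0 dv dvw.
pose g s := f (p + h *: w + s *: v) - f (p + s *: v).
have dg (s : R) : is_derive s 1 g ('D_v f (p + h *: w + s *: v) - 'D_v f (p + s *: v)).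
  by apply: is_deriveB; apply: is_derive_line.
have cg : {within `[0, h], continuous g}.
  apply: continuous_subspaceT => s; apply/differentiable_continuous/derivable1_diffP.
  by case: (dg s).
have [s /itvP sh gs] := MVT h0 (fun s _ => dg s) cg.
pose k (t : R) := 'D_v f (p + s *: v + t *: w).
have dk (t : R) : is_derive t 1 k ('D_w ('D_v f) (p + s *: v + t *: w)) by apply: is_derive_line.
have ck : {within `[0, h], continuous k}.
  apply: continuous_subspaceT => t; apply/differentiable_continuous/derivable1_diffP.
  by case: (dk t).
have [t /itvP th kt] := MVT h0 (fun t _ => dk t) ck.
exists s, t; split; rewrite ?sh ?th//.
move: gs kt; rewrite /g /k !scale0r !addr0 !subr0 (addrAC p (s *: v)) => gs kt.
rewrite kt in gs; rewrite (addrAC p (h *: v)).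
by apply: (etrans _ (etrans gs _)); ring.
Qed.

Lemma continuous_eq_at (A B : V -> R) v w p : continuous A -> continuous B ->
  (forall h : R, 0 < h -> exists q q', [/\ A q = B q',
    `|p - q| <= h * (`|v| + `|w|) & `|p - q'| <= h * (`|v| + `|w|)]) ->
  A p = B p.
Proof.
move=> cA cB AB.
apply/eqP; rewrite -subr_eq0 -normr_le0; apply/ler_addgt0Pr => e e0; rewrite add0r.
have e2 : 0 < e / 2 by rewrite divr_gt0.
have /cvgrPdist_lt/(_ _ e2)/nbhs_normP[d1 /= d10 h1] := cA p.
have /cvgrPdist_lt/(_ _ e2)/nbhs_normP[d2 /= d20 h2] := cB p.
pose N := `|v| + `|w| + 1.
have N0 : 0 < N by rewrite ltr_wpDl// addr_ge0.
pose h := Num.min d1 d2 / N.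
have h0 : 0 < h by rewrite divr_gt0// lt_min d10.
have hN : h * (`|v| + `|w|) < Num.min d1 d2.
  rewrite -[ltRHS](mulfVK (lt0r_neq0 N0)) -/h ltr_pM2l//.
  by rewrite /N ltrDl.
have [q [q' [E pq pq']]] := AB h h0.
have := le_lt_trans pq hN; have := le_lt_trans pq' hN; rewrite !lt_min.
move=> /andP[_ /h2 /=] + /andP[/h1 /= + _]; rewrite E => {}h2 {}h1.
apply: le_trans (ler_distD (B q') _ _) _.
rewrite (distrC (B q')); lra.
Qed.

(** The second difference is symmetric in [v] and [w], so the two mixed derivatives take a common
    value at points within [h (|v| + |w|)] of [p]; continuity concludes. *)
Lemma derive_comm f v w p :
  (forall q, derivable f q v) -> (forall q, derivable f q w) ->
  (forall q, derivable ('D_v f) q w) -> (forall q, derivable ('D_w f) q v) ->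
  continuous ('D_w ('D_v f)) -> continuous ('D_v ('D_w f)) ->
  'D_w ('D_v f) p = 'D_v ('D_w f) p.
Proof.
move=> dv dw dvw dwv cvw cwv; apply: (@continuous_eq_at ('D_w ('D_v f)) ('D_v ('D_w f)) v w p cvw cwv) => h h0.
have close (s t : R) (x y : V) : 0 <= s <= h -> 0 <= t <= h ->
    `|p - (p + s *: x + t *: y)| <= h * (`|x| + `|y|).
  move=> /andP[s0 sh] /andP[t0 th].
  rewrite -addrA opprD addrA subrr add0r normrN mulrDr.
  apply: (le_trans (ler_normD _ _)); rewrite !normrZ !ger0_norm//.
  by rewrite lerD// ler_wpM2r.
have [s [t [sh th]]] := second_difference p h0 dv dvw.
have [s' [t' [sh' th']]] := second_difference p h0 dw dwv.
rewrite (addrAC p (h *: w)) (addrAC (f (p + h *: v + h *: w))).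
move=> -> E; exists (p + s *: v + t *: w), (p + s' *: w + t' *: v); split.
- exact: esym (mulfI (lt0r_neq0 (exprn_gt0 2 h0)) E).
- exact: close.
- by rewrite (addrC `|v|); exact: close.
Qed.

End Schwarz.

Section TestFunctions.
Context {R : realType}.
Implicit Types (phi psi : R * R * R -> R) (i j : 'I_3).

Lemma test_function_continuous phi : test_function phi -> continuous phi.
Proof. by move=> [/(_ 0)[]]. Qed.

Lemma test_function_supported phi : test_function phi -> compactly_supported phi.
Proof. by move=> tphi; split; [exact: test_function_continuous|case: tphi]. Qed.

Lemma test_function_derivable i phi p : test_function phi -> derivable phi p (basis_vec R i).
Proof. by move=> [/(_ 1)/= [_ [+ _]]]; exact. Qed.

Lemma test_function_partial i phi : test_function phi -> test_function (partial i phi).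
Proof.
move=> [Cphi kphi]; split; first by move=> n; have [_ [_ C]] := Cphi n.+1; exact: C.
apply: (subclosed_compact _ kphi); first exact: closed_closure.
rewrite [X in _ `<=` X](closure_id _).1; last exact: closed_closure.
apply: closure_subset => p /=; apply: contra_neqP => np.
rewrite /partial (@near_eq_derive _ _ _ _ (cst 0)) ?derive_cst//.
have /open_nbhs_nbhs : open_nbhs p (~` closure [set x | phi x != 0]).
  by split => //; apply: closed_openC; exact: closed_closure.
apply: filterS => q nq; apply/eqP/negPn/negP => /= qq; apply: nq.
exact: subset_closure.
Qed.

Lemma partial_comm i j phi : test_function phi ->
  partial i (partial j phi) = partial j (partial i phi).
Proof.
move=> tphi; apply/funext => p; apply: derive_comm => [q|q|q|q||].
- exact: test_function_derivable.
- exact: test_function_derivable.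
- by apply: test_function_derivable; exact: test_function_partial.
- by apply: test_function_derivable; exact: test_function_partial.
- by apply: test_function_continuous; do 2 apply: test_function_partial.
- by apply: test_function_continuous; do 2 apply: test_function_partial.
Qed.

Lemma partialM_integral_eq0 i phi psi : test_function phi -> test_function psi ->
  (\int[leb3 R]_p (phi p * partial i psi p))%R = - (\int[leb3 R]_p (partial i phi p * psi p))%R.
Proof.
move=> tphi tpsi.
have dphi p := @test_function_derivable i phi p tphi.
have dpsi p := @test_function_derivable i psi p tpsi.
have tphi' := test_function_partial i tphi; have tpsi' := test_function_partial i tpsi.
have E : partial i (fun p => phi p * psi p) = (fun p => phi p * partial i psi p + partial i phi p * psi p).
  apply/funext => p; rewrite /partial (_ : (fun p => _) = phi * psi)// deriveM//.
  by rewrite /GRing.scale/= (mulrC (psi p)).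
have k1 := compactly_supportedM (test_function_supported tphi) (test_function_continuous tpsi').
have k2 := compactly_supportedM (test_function_supported tphi') (test_function_continuous tpsi).
have k0 := compactly_supportedM (test_function_supported tphi) (test_function_continuous tpsi).
have i1 := compactly_supported_integrable k1; have i2 := compactly_supported_integrable k2.
have : (\int[leb3 R]_p (partial i (fun p => phi p * psi p) p)%:E = 0)%E.
  apply: (integral_partial_eq0 k0) => [p|].
    exact: (@derivableM _ _ phi psi p _ (dphi p) (dpsi p)).
  rewrite E; split.
    by move=> p; apply: cvgD; [exact: k1.1|exact: k2.1].
  apply: (subclosed_compact _ (compactU k1.2 k2.2)); first exact: closed_closure.
  rewrite -closureU; apply: closure_subset => p /= h.
  have [h0|] := eqVneq (phi p * partial i psi p) 0; last by left.
  by right; move: h; rewrite h0 add0r.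
rewrite E => h; apply/eqP; rewrite -addr_eq0 -RintegralD//.
by rewrite /Rintegral h.
Qed.

End TestFunctions.

(** * Products of inner products and equivalent norms *)

Section ProductInnerProducts.
Context {R : realType}.

Lemma is_ip_scale (X : lmodType R) (ip : X -> X -> R) (w : R) : 0 <= w -> is_ip ip ->
  is_ip (fun u v => w * ip u v).
Proof.
move=> w0 [C L P]; split => [u v|a u v z|u]; first by rewrite C.
  by rewrite L; ring.
by rewrite mulr_ge0.
Qed.

Lemma is_ip_pair (X Y : lmodType R) (ip1 : X -> X -> R) (ip2 : Y -> Y -> R) :
  is_ip ip1 -> is_ip ip2 -> is_ip (fun u v : X * Y => ip1 u.1 v.1 + ip2 u.2 v.2).
Proof.
move=> [C1 L1 P1] [C2 L2 P2]; split => [u v|a u v z|u]; first by rewrite C1 C2.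
  by rewrite /= L1 L2; ring.
by rewrite addr_ge0.
Qed.

Lemma is_ip_ffun (I : finType) (X : lmodType R) (ip : X -> X -> R) : is_ip ip ->
  is_ip (fun u v : {ffun I -> X} => \sum_i ip (u i) (v i)).
Proof.
move=> [C L P]; split => [u v|a u v z|u].
- by apply: eq_bigr => i _; rewrite C.
- by rewrite mulr_sumr -big_split/=; apply: eq_bigr => i _; rewrite !ffunE L.
- by apply: sumr_ge0.
Qed.

Lemma cvg_ipnorm (X : lmodType R) (ip : X -> X -> R) (s : nat -> X) x : is_ip ip ->
  ip (s n - x) (s n - x) @[n --> \oo] --> (0 : R) <->
  ipnorm ip (s n - x) @[n --> \oo] --> (0 : R).
Proof.
move=> ipP; split=> h; last first.
  have h2 : ipnorm ip (s n - x) * ipnorm ip (s n - x) @[n --> \oo] --> (0 : R).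
    by rewrite -[X in _ --> X](mulr0 (0 : R)); exact: cvgM.
  by under eq_fun do rewrite -(sqr_nrm ipP) expr2; exact: h2.
by rewrite -(@sqrtr0 R); exact: (@continuous_cvg _ R R _ _ _ Num.sqrt _ (@sqrt_continuous R _) h).
Qed.

Lemma ip_complete_scale (X : lmodType R) (ip : X -> X -> R) (w : R) : 0 < w -> is_ip ip ->
  ip_complete ip -> ip_complete (fun u v => w * ip u v).
Proof.
move=> w0 ipP cip s sC.
have E x : ipnorm (fun u v => w * ip u v) x = Num.sqrt w * ipnorm ip x.
  by rewrite /ipnorm sqrtrM// ltW.
have sw : 0 < Num.sqrt w by rewrite sqrtr_gt0.
have [e e0|x xP] := cip s.
  have [n0 n0P] := sC _ (mulr_gt0 sw e0); exists n0 => n m hn hm.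
  by rewrite -(ltr_pM2l sw) -E; exact: n0P.
have h : Num.sqrt w * ipnorm ip (s n - x) @[n --> \oo] --> (0 : R).
  by rewrite -[X in _ --> X](mulr0 (Num.sqrt w)); apply: cvgM => //; exact: cvg_cst.
by exists x; under eq_fun do rewrite E; exact: h.
Qed.

Lemma ip_complete_pair (X Y : lmodType R) (ip1 : X -> X -> R) (ip2 : Y -> Y -> R) :
  is_ip ip1 -> is_ip ip2 -> ip_complete ip1 -> ip_complete ip2 ->
  ip_complete (fun u v : X * Y => ip1 u.1 v.1 + ip2 u.2 v.2).
Proof.
move=> ip1P ip2P c1 c2 s sC.
have [e e0|x xP] := c1 (fun n => (s n).1).
  have [n0 n0P] := sC e e0; exists n0 => n m hn hm.
  by apply: le_lt_trans (n0P n m hn hm); apply: ler_wsqrtr; rewrite lerDl (ip_ge0 ip2P).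
have [e e0|y yP] := c2 (fun n => (s n).2).
  have [n0 n0P] := sC e e0; exists n0 => n m hn hm.
  by apply: le_lt_trans (n0P n m hn hm); apply: ler_wsqrtr; rewrite lerDr (ip_ge0 ip1P).
exists (x, y); apply/(cvg_ipnorm _ _ (is_ip_pair ip1P ip2P)) => /=.
rewrite -[X in _ --> X](addr0 (0 : R)).
by apply: cvgD; [exact/(cvg_ipnorm (fun n => (s n).1) _ ip1P)|exact/(cvg_ipnorm (fun n => (s n).2) _ ip2P)].
Qed.

Lemma ip_complete_ffun (I : finType) (X : lmodType R) (ip : X -> X -> R) :
  is_ip ip -> ip_complete ip -> ip_complete (fun u v : {ffun I -> X} => \sum_i ip (u i) (v i)).
Proof.
move=> ipP cip s sC.
have /choice[x xP] : forall i, exists x, ipnorm ip (s n i - x) @[n --> \oo] --> (0 : R).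
  move=> i; apply: (cip (fun n => s n i)) => e e0.
  have [n0 n0P] := sC e e0; exists n0 => n m hn hm.
  apply: le_lt_trans (n0P n m hn hm); apply: ler_wsqrtr.
  rewrite (bigD1 i)//= !ffunE lerDl.
  by apply: sumr_ge0 => j _; exact: (ip_ge0 ipP).
exists (finfun x); apply/(cvg_ipnorm _ _ (is_ip_ffun I ipP)) => /=.
have h : \sum_i ip (s n i - x i) (s n i - x i) @[n --> \oo] --> \sum_(i : I) (0 : R).
  apply: (@cvg_big R I +%R 0 xpredT (@add_continuous R)) => i _.
  exact/(cvg_ipnorm (fun n => s n i) _ ipP).
rewrite big1// in h; move: h; apply: cvg_trans; apply: near_eq_cvg; apply: nearW => n /=.
by apply: eq_bigr => i _; rewrite !ffunE.
Qed.

End ProductInnerProducts.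

Section EquivalentNorms.
Context {R : realType} {X : lmodType R} (N N' : X -> R) (c c' : R).
Hypotheses (c0 : 0 <= c) (N0 : forall u, 0 <= N u) (N'0 : forall u, 0 <= N' u)
  (NN' : forall u, N' u <= c * N u) (N'N : forall u, N u <= c' * N' u).

Lemma null_eq_equiv u v : null_eq N u v <-> null_eq N' u v.
Proof.
rewrite /null_eq; split=> h; apply/le_anti.
  by rewrite N'0 andbT (le_trans (NN' _))// h mulr0.
by rewrite N0 andbT (le_trans (N'N _))// h mulr0.
Qed.

Lemma cvg_equiv_norm (T : Type) (F : set_system T) {FF : Filter F} (f : T -> X) :
  N (f t) @[t --> F] --> (0 : R) <-> N' (f t) @[t --> F] --> (0 : R).
Proof.
split=> h.
  have h' : c * N (f t) @[t --> F] --> (0 : R).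
    by rewrite -[X in _ --> X](mulr0 c); apply: cvgM => //; exact: cvg_cst.
  by apply: (ger0_cvgr0_le h') => //; exact: nearW.
have h' : c' * N' (f t) @[t --> F] --> (0 : R).
  by rewrite -[X in _ --> X](mulr0 c'); apply: cvgM => //; exact: cvg_cst.
by apply: (ger0_cvgr0_le h') => //; exact: nearW.
Qed.

(** The semigroup is given for the unweighted norm of [state_norm], while the energy argument needs
    the weighted one. *)
Lemma C0_semigroup_equiv T : C0_semigroup N T -> C0_semigroup N' T.
Proof.
move=> [H1 H2 H3 H4 H5]; split.
- by move=> t t0 a u v; apply/null_eq_equiv; exact: H1.
- move=> t t0; have [M HM] := H2 t t0; exists (c * `|M| * c') => u.
  apply: (le_trans (NN' _)); rewrite -!mulrA ler_wpM2l//.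
  apply: (le_trans (HM _)).
  apply: (@le_trans _ _ (`|M| * N u)); first by rewrite ler_wpM2r// ler_norm.
  by rewrite ler_wpM2l.
- by move=> u; apply/null_eq_equiv; exact: H3.
- by move=> s t s0 t0 u; apply/null_eq_equiv; exact: H4.
- by move=> u s s0; apply/(cvg_equiv_norm (fun t => T t u - T s u)); exact: H5.
Qed.

Lemma generates_equiv G T : generates N G T -> generates N' G T.
Proof.
move=> H u f; split=> [/H|h].
  by move/(cvg_equiv_norm (fun h => h^-1 *: (T h u - u) - f)).
by apply/H/(cvg_equiv_norm (fun h => h^-1 *: (T h u - u) - f)).
Qed.

End EquivalentNorms.

(** * Weak curls *)

Section VectorFields.
Context {R : realType}.
Implicit Types (u v w : vfield R) (f g : Defs.L2 R).

Definition vip u v : R := \sum_i l2ip (u i) (v i).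

Lemma vip_is_ip : is_ip vip.
Proof. exact: (is_ip_ffun 'I_3 (l2ip_is_ip (leb3 R))). Qed.

Lemma vip_complete : ip_complete vip.
Proof. exact: (ip_complete_ffun (l2ip_is_ip (leb3 R)) (@l2_complete _ _ R (leb3 R))). Qed.

Lemma vnormsqE u : vnormsq u = vip u u.
Proof. by apply: eq_bigr => i _; exact: l2norm_sqr. Qed.

Definition single (i : 'I_3) f : vfield R := [ffun l => if l == i then f else 0].

Lemma vip_single u i f : vip u (single i f) = l2ip (u i) f.
Proof.
rewrite /vip (bigD1 i)//= ffunE eqxx big1 ?addr0// => j /negbTE ji.
by rewrite ffunE ji (ip0r (l2ip_is_ip (leb3 R))).
Qed.

Definition testL2 phi (tphi : test_function phi) : Defs.L2 R :=
  Lfun_Sub (lee1n 2) (compactly_supported_Lfun2 (test_function_supported tphi)).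

Lemma pairing_testL2 f phi (tphi : test_function phi) : pairing f phi = l2ip f (testL2 tphi).
Proof. by []. Qed.

(** The classical curl of [phi e_i], namely [d_k phi e_j - d_j phi e_k]. *)
Definition curl_single (i : 'I_3) phi (tphi : test_function phi) : vfield R :=
  let j := ordS i in let k := ordS j in
  single j (testL2 (test_function_partial k tphi)) -
  single k (testL2 (test_function_partial j tphi)).

(** The weak curl is the adjoint of the curl on test fields, and one-component test fields are
    enough to determine it. *)
Lemma is_curlP u w : is_curl u w <-> forall i phi (tphi : test_function phi),
  vip u (curl_single i tphi) = vip w (single i (testL2 tphi)).
Proof.
have E i phi (tphi : test_function phi) : vip u (curl_single i tphi) =
    - (pairing (u (ordS (ordS i))) (partial (ordS i) phi) -
       pairing (u (ordS i)) (partial (ordS (ordS i)) phi)).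
  by rewrite (ipBr vip_is_ip) !vip_single -!pairing_testL2 opprB.
split=> h.
  by move=> i phi tphi; rewrite E (h phi tphi i) opprK vip_single.
move=> phi tphi i /=; have := h i phi tphi; rewrite E vip_single -pairing_testL2.
by move=> <-; rewrite opprK.
Qed.

Lemma testL2_partial i phi psi (tphi : test_function phi) (tpsi : test_function psi) :
  l2ip (testL2 tphi) (testL2 (test_function_partial i tpsi)) =
  - l2ip (testL2 (test_function_partial i tphi)) (testL2 tpsi).
Proof. exact: partialM_integral_eq0. Qed.

Lemma ordS3 (i : 'I_3) : ordS (ordS (ordS i)) = i.
Proof. by apply/val_inj; case: i => -[|[|[|]]]. Qed.

Lemma is_curl_single i phi (tphi : test_function phi) :
  is_curl (single i (testL2 tphi)) (curl_single i tphi).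
Proof.
apply/is_curlP => l psi tpsi.
rewrite (ipC vip_is_ip) !vip_single /curl_single !ffunE.
have S1 (x : 'I_3) : (ordS x == x) = false by case: x => -[|[|[|]]].
have S2 (x : 'I_3) : (x == ordS x) = false by case: x => -[|[|[|]]].
have S3 (x : 'I_3) : (ordS (ordS x) == x) = false by case: x => -[|[|[|]]].
have S4 (x : 'I_3) : (x == ordS (ordS x)) = false by case: x => -[|[|[|]]].
have [->|[->|->]] : l = i \/ l = ordS i \/ l = ordS (ordS i).
- have : [|| l == i, l == ordS i | l == ordS (ordS i)].
    by case: l => -[|[|[|]]] //; case: i => -[|[|[|]]].
  by case/or3P => /eqP; [left|right; left|right; right].
- by rewrite S2 S4 subrr !(ip0l (l2ip_is_ip _)).
- rewrite ordS3 S4 !eqxx S2 sub0r subr0 (ipNl (l2ip_is_ip _)) (ipC (l2ip_is_ip _)).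
  by rewrite testL2_partial opprK.
- rewrite !ordS3 !eqxx S1 S2 subr0 sub0r (ipNl (l2ip_is_ip _)) (ipC (l2ip_is_ip _)).
  exact: testL2_partial.
Qed.
End VectorFields.

(** * The Drude operator *)

Section Drude.
Context {R : realType} (eps0 mu0 Omega_e Omega_m alpha_e alpha_m : R).
Hypotheses (eps0_gt0 : 0 < eps0) (mu0_gt0 : 0 < mu0)
  (Omega_e_gt0 : 0 < Omega_e) (Omega_m_gt0 : 0 < Omega_m)
  (alpha_e_gt0 : 0 < alpha_e) (alpha_m_gt0 : 0 < alpha_m).
Local Notation X := (state R).
Local Notation G := (drude_operator eps0 mu0 Omega_e Omega_m alpha_e alpha_m).
Implicit Types (U V F W : X).

Definition wP := eps0 * Omega_e ^+ 2.
Definition wM := mu0 * Omega_m ^+ 2.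

Lemma wP_gt0 : 0 < wP. Proof. by rewrite mulr_gt0// exprn_gt0. Qed.
Lemma wM_gt0 : 0 < wM. Proof. by rewrite mulr_gt0// exprn_gt0. Qed.

(** With the weights of the energy the couplings of [E] with [P'] and of [H] with [M'] cancel, as do
    the two curl terms on test fields, and only damping remains. *)
Definition sip U V : R :=
  eps0 * vip U.1.1.1 V.1.1.1 + mu0 * vip U.1.1.2 V.1.1.2 + wP * vip U.1.2 V.1.2
  + wM * vip U.2 V.2.

Lemma sip_is_ip : is_ip sip.
Proof.
have h w : 0 < w -> is_ip (fun u v : vfield R => w * vip u v).
  by move=> w0; apply: is_ip_scale; [exact: ltW|exact: vip_is_ip].
exact: (is_ip_pair (is_ip_pair (is_ip_pair (h _ eps0_gt0) (h _ mu0_gt0)) (h _ wP_gt0)) (h _ wM_gt0)).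
Qed.

Lemma sip_complete : ip_complete sip.
Proof.
have h w : 0 < w -> is_ip (fun u v : vfield R => w * vip u v).
  by move=> w0; apply: is_ip_scale; [exact: ltW|exact: vip_is_ip].
have h' w : 0 < w -> ip_complete (fun u v : vfield R => w * vip u v).
  by move=> w0; apply: ip_complete_scale => //; [exact: vip_is_ip|exact: vip_complete].
have p1 := is_ip_pair (h _ eps0_gt0) (h _ mu0_gt0).
have p2 := is_ip_pair p1 (h _ wP_gt0).
have c1 := ip_complete_pair (h _ eps0_gt0) (h _ mu0_gt0) (h' _ eps0_gt0) (h' _ mu0_gt0).
have c2 := ip_complete_pair p1 (h _ wP_gt0) c1 (h' _ wP_gt0).
exact: (ip_complete_pair p2 (h _ wM_gt0) c2 (h' _ wM_gt0)).
Qed.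

Lemma energyE U : energy eps0 mu0 Omega_e Omega_m U = 2^-1 * sip U U.
Proof. by case: U => [[[E H] P] M]; rewrite /energy !vnormsqE. Qed.

Definition dissip U V : R := wP * alpha_e * vip U.1.2 V.1.2 + wM * alpha_m * vip U.2 V.2.

Lemma dissip_is_ip : is_ip dissip.
Proof.
have [C L P] := @vip_is_ip R; split => [U V|a U V W|U]; rewrite /dissip /=.
- by rewrite !(C U.1.2) !(C U.2).
- by rewrite !L; ring.
- by rewrite addr_ge0// mulr_ge0// mulr_ge0// ltW// ?wP_gt0 ?wM_gt0.
Qed.

Lemma dissip_le U : dissip U U <= (alpha_e + alpha_m) * sip U U.
Proof.
have [_ _ p] := @vip_is_ip R.
have e := mulr_ge0 (ltW eps0_gt0) (p U.1.1.1); have m := mulr_ge0 (ltW mu0_gt0) (p U.1.1.2).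
have a := mulr_ge0 (ltW wP_gt0) (p U.1.2); have b := mulr_ge0 (ltW wM_gt0) (p U.2).
rewrite /dissip /sip mulrAC [X in _ + X <= _]mulrAC.
move: e m a b; move: (eps0 * _) (mu0 * _) (wP * _) (wM * _) => e m a b e0 m0 a0 b0.
have := ltW alpha_e_gt0; have := ltW alpha_m_gt0; move=> am ae.
have := mulr_ge0 ae e0; have := mulr_ge0 ae m0; have := mulr_ge0 ae b0.
have := mulr_ge0 am e0; have := mulr_ge0 am m0; have := mulr_ge0 am a0.
lra.
Qed.

(** [E] and [M'] are even under reversal of time, [H] and [P'] odd. The conservative part of the
    operator exchanges the two parities and the damping preserves them. *)
Definition time_reversal U : X := (U.1.1.1, - U.1.1.2, - U.1.2, U.2).

(** Elements with a single nonzero slot, rather than a subspace, so that time reversal acts on each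
    by a sign. The last two slots accept any square-integrable field, the operator being bounded
    there. *)
Inductive core : X -> X -> Prop :=
| core_E i phi (tphi : test_function phi) :
    core (single i (testL2 tphi), 0, 0, 0)
         (0, - (mu0^-1 *: curl_single i tphi), single i (testL2 tphi), 0)
| core_H i phi (tphi : test_function phi) :
    core (0, single i (testL2 tphi), 0, 0)
         (eps0^-1 *: curl_single i tphi, 0, 0, single i (testL2 tphi))
| core_P p : core (0, 0, p, 0) (- (Omega_e ^+ 2 *: p), 0, - (alpha_e *: p), 0)
| core_M p : core (0, 0, 0, p) (0, - (Omega_m ^+ 2 *: p), 0, - (alpha_m *: p)).

Local Notation ipE := (ipE (@vip_is_ip R)).

Lemma time_reversal_adjoint U V : sip (time_reversal U) V = sip U (time_reversal V).
Proof. by rewrite /sip /= !ipE; ring. Qed.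

Lemma dissip_time_reversal U V : dissip (time_reversal U) V = dissip U (time_reversal V).
Proof. by rewrite /dissip /= !ipE; ring. Qed.

Lemma time_reversal_norm U : ipnorm sip (time_reversal U) = ipnorm sip U.
Proof.
rewrite /ipnorm time_reversal_adjoint /time_reversal /= !opprK.
by case: U => [[[]]].
Qed.

Lemma core_time_reversal V F : core V F -> exists2 s : R, time_reversal V = s *: V &
  forall W, sip W (s *: F) + sip (time_reversal W) F = - (2 * dissip W (time_reversal V)).
Proof.
have scal (s : R) (u v w z : vfield R) : s *: ((u, v, w, z) : X) = (s *: u, s *: v, s *: w, s *: z) by [].
case=> [i phi tphi|i phi tphi|p|p].
- exists 1; rewrite !scal ?scale1r /time_reversal /= ?oppr0 ?scaler0//.
  by move=> W; rewrite /sip /dissip /= !ipE; ring.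
- exists (-1); rewrite !scal ?scaleN1r /time_reversal /= ?oppr0 ?scaler0//.
  by move=> W; rewrite /sip /dissip /= !ipE; ring.
- exists (-1); rewrite !scal ?scaleN1r /time_reversal /= ?oppr0 ?scaler0//.
  by move=> W; rewrite /sip /dissip /= !ipE /wP; ring.
- exists 1; rewrite !scal ?scale1r /time_reversal /= ?oppr0 ?scaler0//.
  by move=> W; rewrite /sip /dissip /= !ipE /wM; ring.
Qed.

Definition state_weight_max := eps0 + mu0 + wP + wM.

Lemma state_normE U : state_norm U =
  Num.sqrt (vip U.1.1.1 U.1.1.1 + vip U.1.1.2 U.1.1.2 + vip U.1.2 U.1.2 + vip U.2 U.2).
Proof. by case: U => [[[E H] P] M]; rewrite /state_norm !vnormsqE. Qed.

Lemma sip_le_state_norm U : ipnorm sip U <= Num.sqrt state_weight_max * state_norm U.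
Proof.
have [_ _ p] := @vip_is_ip R.
rewrite state_normE -sqrtrM; last first.
  by rewrite !addr_ge0// ltW// ?wP_gt0 ?wM_gt0.
apply: ler_wsqrtr; rewrite /sip /state_weight_max.
have := p U.1.1.1; have := p U.1.1.2; have := p U.1.2; have := p U.2.
move: (vip U.1.1.1 _) (vip U.1.1.2 _) (vip U.1.2 _) (vip U.2 _) => a b c d d0 c0 b0 a0.
have := ltW wP_gt0; have := ltW wM_gt0; have := ltW eps0_gt0; have := ltW mu0_gt0.
move: wP wM eps0 mu0 => x y z t *; nra.
Qed.

Lemma state_norm_le_sip U : state_norm U <= Num.sqrt (eps0^-1 + mu0^-1 + wP^-1 + wM^-1) * ipnorm sip U.
Proof.
have [_ _ p] := @vip_is_ip R.
have i1 : 0 < eps0^-1 by rewrite invr_gt0.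
have i2 : 0 < mu0^-1 by rewrite invr_gt0.
have i3 : 0 < wP^-1 by rewrite invr_gt0 wP_gt0.
have i4 : 0 < wM^-1 by rewrite invr_gt0 wM_gt0.
rewrite state_normE -sqrtrM; last by rewrite !addr_ge0// ltW.
apply: ler_wsqrtr.
have e (w a : R) : 0 < w -> a = w^-1 * (w * a) by move=> w0; rewrite mulKf// gt_eqF.
rewrite {1}(e _ (vip U.1.1.1 _) eps0_gt0) {1}(e _ (vip U.1.1.2 _) mu0_gt0).
rewrite {1}(e _ (vip U.1.2 _) wP_gt0) {1}(e _ (vip U.2 _) wM_gt0) /sip.
have := mulr_ge0 (ltW eps0_gt0) (p U.1.1.1); have := mulr_ge0 (ltW mu0_gt0) (p U.1.1.2).
have := mulr_ge0 (ltW wP_gt0) (p U.1.2); have := mulr_ge0 (ltW wM_gt0) (p U.2).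
move: (eps0 * _) (mu0 * _) (wP * _) (wM * _) => a b c d d0 c0 b0 a0.
move: (eps0^-1) (mu0^-1) (wP^-1) (wM^-1) (ltW i1) (ltW i2) (ltW i3) (ltW i4) => x y z t x0 y0 z0 t0.
have := mulr_ge0 x0 b0; have := mulr_ge0 x0 c0; have := mulr_ge0 x0 d0.
have := mulr_ge0 y0 a0; have := mulr_ge0 y0 c0; have := mulr_ge0 y0 d0.
have := mulr_ge0 z0 b0; have := mulr_ge0 z0 a0; have := mulr_ge0 z0 d0.
have := mulr_ge0 t0 b0; have := mulr_ge0 t0 c0; have := mulr_ge0 t0 a0.
lra.
Qed.

End Drude.

(** * The Drude operator characterised by Green's identity *)

Section DrudeGenerator.
Context {R : realType} (eps0 mu0 Omega_e Omega_m alpha_e alpha_m : R).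
Hypotheses (eps0_gt0 : 0 < eps0) (mu0_gt0 : 0 < mu0)
  (Omega_e_gt0 : 0 < Omega_e) (Omega_m_gt0 : 0 < Omega_m)
  (alpha_e_gt0 : 0 < alpha_e) (alpha_m_gt0 : 0 < alpha_m).
Local Notation X := (state R).
Local Notation G := (drude_operator eps0 mu0 Omega_e Omega_m alpha_e alpha_m).
Local Notation wP := (wP eps0 Omega_e).
Local Notation wM := (wM mu0 Omega_m).
Local Notation sip := (sip eps0 mu0 Omega_e Omega_m).
Local Notation dissip := (dissip eps0 mu0 Omega_e Omega_m alpha_e alpha_m).
Local Notation core := (core eps0 mu0 Omega_e Omega_m alpha_e alpha_m).
Local Notation sipP := (sip_is_ip eps0_gt0 mu0_gt0 Omega_e_gt0 Omega_m_gt0).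
Local Notation vipP := (@vip_is_ip R).
Local Notation ipE := (ipE (@vip_is_ip R)).
Local Notation ip0E := (ip0l (@vip_is_ip R), ip0r (@vip_is_ip R)).
Implicit Types (U V F W : X).

Lemma state_norm_sip_null U V : null_eq (@state_norm R) U V <-> null_eq (ipnorm sip) U V.
Proof.
have N0 W : 0 <= state_norm W by rewrite state_normE sqrtr_ge0.
exact: (null_eq_equiv N0 (nrm_ge0 sip)
  (sip_le_state_norm eps0_gt0 mu0_gt0 Omega_e_gt0 Omega_m_gt0)
  (state_norm_le_sip eps0_gt0 mu0_gt0 Omega_e_gt0 Omega_m_gt0)).
Qed.

Lemma null_state (E H P M E' H' P' M' : vfield R) : E = E' -> H = H' ->
  (forall p, vip (P - P') p = 0) -> (forall p, vip (M - M') p = 0) ->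
  null_eq (@state_norm R) (E, H, P, M) (E', H', P', M').
Proof.
move=> <- <- hP hM; rewrite /null_eq state_normE.
have -> : (E, H, P, M) - (E, H, P', M') = (0, 0, P - P', M - M') :> X.
  by congr (_, _, _, _); exact: subrr.
by rewrite /= hP hM !ip0E !addr0 sqrtr0.
Qed.

Lemma vipEE (u v w : vfield R) : vip (eps0^-1 *: u - Omega_e ^+ 2 *: v) w =
  eps0^-1 * vip u w - Omega_e ^+ 2 * vip v w.
Proof. by rewrite (ipBl vipP) !(ipZl vipP). Qed.

Lemma vipHE (u v w : vfield R) : vip (- (mu0^-1 *: u) - Omega_m ^+ 2 *: v) w =
  - (mu0^-1 * vip u w) - Omega_m ^+ 2 * vip v w.
Proof. by rewrite (ipBl vipP) (ipNl vipP) !(ipZl vipP). Qed.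

Lemma vipPE (a : R) (u v w : vfield R) : vip (u - a *: v) w = vip u w - a * vip v w.
Proof. by rewrite (ipBl vipP) (ipZl vipP). Qed.

(** Each kind of core element tests one equation of the system: [core_E] and [core_H] yield the weak
    curls of [H] and [E], while [core_P] and [core_M] yield the two damped equations against
    arbitrary fields. *)
Lemma drude_adjoint U F : G U F <->
  forall V K, core V K -> sip F V + sip U K = - (2 * dissip U V).
Proof.
have e0 : eps0 != 0 by rewrite gt_eqF.
have m0 : mu0 != 0 by rewrite gt_eqF.
have p0 : wP != 0 by rewrite gt_eqF// wP_gt0.
have q0 : wM != 0 by rewrite gt_eqF// wM_gt0.
case: U => [[[E H] P] M]; split=> [[rotE [rotH [/is_curlP cE /is_curlP cH /state_norm_sip_null FU]]] V K|].
  have -> := ip_eql sipP V FU; move: V K {FU F}.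
  move: (_ - _ : vfield R) (vipEE rotH P) => FE FEE.
  move: (_ - _ : vfield R) (vipHE rotE M) => FH FHE.
  move: (_ - _ : vfield R) (vipPE alpha_e E P) => FP FPE.
  move: (_ - _ : vfield R) (vipPE alpha_m H M) => FM FME.
  move=> V K; case=> [i phi tphi|i phi tphi|p|p].
  - move: (curl_single i tphi) (single i _) (cH i phi tphi) => c f cf.
    rewrite /sip /dissip /= !ip0E FEE (ipNr vipP) (ipZr vipP) cf.
    rewrite !(mulr0, addr0, add0r, oppr0, subr0).
    by move: (vip rotH f) (vip P f) => x y; rewrite /wP; field; exact/andP.
  - move: (curl_single i tphi) (single i _) (cE i phi tphi) => c f cf.
    rewrite /sip /dissip /= !ip0E FHE (ipZr vipP) cf.
    rewrite !(mulr0, addr0, add0r, oppr0, subr0).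
    by move: (vip rotE f) (vip M f) => x y; rewrite /wM; field; exact/andP.
  - rewrite /sip /dissip /= !ip0E FPE (ipNr vipP) (ipZr vipP) (ipNr vipP) (ipZr vipP).
    by rewrite /wP; ring.
  - rewrite /sip /dissip /= !ip0E FME (ipNr vipP) (ipZr vipP) (ipNr vipP) (ipZr vipP).
    by rewrite /wM; ring.
move: F => [[[FE FH] FP] FM] h.
(* The curls are solved from the first two equations, so only the last two components remain to be
   compared up to null vectors. *)
exists (- (mu0 *: (FH + Omega_m ^+ 2 *: M))), (eps0 *: (FE + Omega_e ^+ 2 *: P)); split.
- apply/is_curlP => i phi tphi.
  have := h _ _ (core_H eps0 mu0 Omega_e Omega_m alpha_e alpha_m i tphi).
  move: (curl_single i tphi) (single i _) => c f.
  rewrite /sip /dissip /= !ip0E !ipE !(mulr0, addr0, add0r, oppr0, subr0) mulrA mulfV// mul1r /wM.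
  by move=> hh; lra.
- apply/is_curlP => i phi tphi.
  have := h _ _ (core_E eps0 mu0 Omega_e Omega_m alpha_e alpha_m i tphi).
  move: (curl_single i tphi) (single i _) => c f.
  rewrite /sip /dissip /= !ip0E !ipE !(mulr0, addr0, add0r, oppr0, subr0) mulrN mulrA mulfV// mul1r /wP.
  by move=> hh; lra.
have hP p : vip (FP - (E - alpha_e *: P)) p = 0.
  have := h _ _ (core_P eps0 mu0 Omega_e Omega_m alpha_e alpha_m p).
  rewrite (ipBl vipP) vipPE /sip /dissip /= !ip0E !ipE !(mulr0, addr0, add0r, oppr0, subr0).
  move: (vip FP p) (vip E p) (vip P p) => x y z hh.
  apply: (mulfI p0); rewrite mulr0; move: hh; rewrite /wP => hh; lra.
have hM p : vip (FM - (H - alpha_m *: M)) p = 0.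
  have := h _ _ (core_M eps0 mu0 Omega_e Omega_m alpha_e alpha_m p).
  rewrite (ipBl vipP) vipPE /sip /dissip /= !ip0E !ipE !(mulr0, addr0, add0r, oppr0, subr0).
  move: (vip FM p) (vip H p) (vip M p) => x y z hh.
  apply: (mulfI q0); rewrite mulr0; move: hh; rewrite /wM => hh; lra.
apply: null_state hP hM.
  by rewrite scalerA mulVf// scale1r addrK.
by rewrite scalerN scalerA mulVf// scale1r opprK addrK.
Qed.

End DrudeGenerator.

(** * Observability and decay for the Drude semigroup *)

Section DrudeDecay.
Context {R : realType} (eps0 mu0 Omega_e Omega_m alpha_e alpha_m : R).
Hypotheses (eps0_gt0 : 0 < eps0) (mu0_gt0 : 0 < mu0)
  (Omega_e_gt0 : 0 < Omega_e) (Omega_m_gt0 : 0 < Omega_m)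
  (alpha_e_gt0 : 0 < alpha_e) (alpha_m_gt0 : 0 < alpha_m).
Local Notation X := (state R).
Local Notation G := (drude_operator eps0 mu0 Omega_e Omega_m alpha_e alpha_m).
Local Notation wP := (wP eps0 Omega_e).
Local Notation wM := (wM mu0 Omega_m).
Local Notation sip := (sip eps0 mu0 Omega_e Omega_m).
Local Notation dissip := (dissip eps0 mu0 Omega_e Omega_m alpha_e alpha_m).
Local Notation core := (core eps0 mu0 Omega_e Omega_m alpha_e alpha_m).
Local Notation sipP := (sip_is_ip eps0_gt0 mu0_gt0 Omega_e_gt0 Omega_m_gt0).
Local Notation sip_complete := (sip_complete eps0_gt0 mu0_gt0 Omega_e_gt0 Omega_m_gt0).
Local Notation dissipP := (dissip_is_ip eps0_gt0 mu0_gt0 Omega_e_gt0 Omega_m_gt0 alpha_e_gt0 alpha_m_gt0).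
Local Notation adjoint := (drude_adjoint alpha_e alpha_m eps0_gt0 mu0_gt0 Omega_e_gt0 Omega_m_gt0).
Local Notation vipP := (@vip_is_ip R).
Local Notation ip0E := (ip0l (@vip_is_ip R), ip0r (@vip_is_ip R)).
Implicit Types (U V F W : X).

Lemma is_curl0 : is_curl (0 : vfield R) 0.
Proof. by apply/is_curlP => i phi tphi; rewrite !ip0E. Qed.

Lemma null_state_refl (E H P M E' H' P' M' : vfield R) : E = E' -> H = H' -> P = P' -> M = M' ->
  null_eq (@state_norm R) (E, H, P, M) (E', H', P', M').
Proof. by move=> -> -> -> ->; apply: null_state => // p; rewrite subrr ip0E. Qed.

Lemma core_sub U F : core U F -> G U F.
Proof.
case=> [i phi tphi|i phi tphi|p|p].
- exists (curl_single i tphi), 0; split; [exact: is_curl_single|exact: is_curl0|].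
  by apply: null_state_refl; rewrite ?(scaler0, oppr0, addr0, add0r).
- exists 0, (curl_single i tphi); split; [exact: is_curl0|exact: is_curl_single|].
  by apply: null_state_refl; rewrite ?(scaler0, oppr0, addr0, add0r).
- exists 0, 0; split; [exact: is_curl0|exact: is_curl0|].
  by apply: null_state_refl; rewrite ?(scaler0, oppr0, addr0, add0r).
- exists 0, 0; split; [exact: is_curl0|exact: is_curl0|].
  by apply: null_state_refl; rewrite ?(scaler0, oppr0, addr0, add0r).
Qed.

Lemma drude_polarization U F : G U F ->
  (forall p, vip F.1.2 p = vip U.1.1.1 p - alpha_e * vip U.1.2 p) /\
  (forall p, vip F.2 p = vip U.1.1.2 p - alpha_m * vip U.2 p).
Proof.
have p0 : wP != 0 by rewrite gt_eqF// wP_gt0.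
have q0 : wM != 0 by rewrite gt_eqF// wM_gt0.
move: U F => [[[E H] P] M] [[[FE FH] FP] FM] /adjoint h /=; split => p.
- have := h _ _ (core_P eps0 mu0 Omega_e Omega_m alpha_e alpha_m p).
  rewrite /sip /dissip /= !ip0E (ipNr vipP) (ipZr vipP) (ipNr vipP) (ipZr vipP) !(mulr0, addr0, add0r).
  move: (vip FP p) (vip E p) (vip P p) => x y z hh.
  apply: (mulfI p0); move: hh; rewrite /wP; lra.
- have := h _ _ (core_M eps0 mu0 Omega_e Omega_m alpha_e alpha_m p).
  rewrite /sip /dissip /= !ip0E (ipNr vipP) (ipZr vipP) (ipNr vipP) (ipZr vipP) !(mulr0, addr0, add0r).
  move: (vip FM p) (vip H p) (vip M p) => x y z hh.
  apply: (mulfI q0); move: hh; rewrite /wM; lra.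
Qed.

(** This is [|f + a p|^2 <= 2 |f|^2 + 2 a^2 |p|^2]; the relation [e = f + a p] is available only
    through pairings, since the operator is defined up to null vectors. *)
Lemma vip_damped (a : R) (e f p : vfield R) :
  (forall q, vip f q = vip e q - a * vip p q) -> vip e e <= 2 * vip f f + 2 * a ^+ 2 * vip p p.
Proof.
move=> h.
have E q : vip e q = vip f q + a * vip p q by rewrite h subrK.
have -> : vip e e = vip f f + 2 * (a * vip f p) + a ^+ 2 * vip p p.
  rewrite E (ipC vipP f e) (ipC vipP p e) !E (ipC vipP p f); ring.
have := ip_ge0 vipP (f - a *: p).
rewrite (ipBl vipP) (ipZl vipP) !(ipBr vipP) !(ipZr vipP) (ipC vipP p f).
by move: (vip f f) (vip f p) (vip p p) => x y z hh; nra.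
Qed.

(** The sum of the constants of [block_observability] for the electric pair [(E, P')] and the
    magnetic pair [(H, M')]. *)
Definition observability_const : R :=
  (2 * eps0 + 2 * eps0 * alpha_e ^+ 2 + wP) / (wP * alpha_e) +
  (2 * mu0 + 2 * mu0 * alpha_m ^+ 2 + wM) / (wM * alpha_m).

Lemma observability_const_gt0 : 0 < observability_const.
Proof.
have p0 := wP_gt0 eps0_gt0 Omega_e_gt0; have q0 := wM_gt0 mu0_gt0 Omega_m_gt0.
by apply: addr_gt0; apply: divr_gt0; rewrite ?mulr_gt0// !addr_gt0// !mulr_gt0// exprn_gt0.
Qed.

Lemma block_observability (w g a x y z : R) : 0 < w -> 0 < g -> 0 < a -> 0 <= y -> 0 <= z ->
  x <= 2 * z + 2 * a ^+ 2 * y ->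
  w * x + g * y <= (2 * w + 2 * w * a ^+ 2 + g) / (g * a) * (g * a * (y + z)).
Proof.
move=> w0 g0 a0 y0 z0 h.
rewrite mulrA divfK; last by rewrite mulf_neq0 ?gt_eqF.
have h1 : w * x <= w * (2 * z + 2 * a ^+ 2 * y) by rewrite ler_pM2l.
have := mulr_ge0 (ltW w0) y0; have := mulr_ge0 (ltW g0) z0.
have := mulr_ge0 (mulr_ge0 (ltW w0) (sqr_ge0 a)) z0.
rewrite mulrDl mulrDl => k1 k2 k3; lra.
Qed.

Lemma drude_observability U F : G U F ->
  sip U U <= observability_const * (dissip U U + dissip F F).
Proof.
move=> /drude_polarization[/vip_damped hE /vip_damped hM].
have p0 := wP_gt0 eps0_gt0 Omega_e_gt0; have q0 := wM_gt0 mu0_gt0 Omega_m_gt0.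
have [_ _ P] := vipP.
have bE := block_observability eps0_gt0 p0 alpha_e_gt0 (P U.1.2) (P F.1.2) hE.
have bM := block_observability mu0_gt0 q0 alpha_m_gt0 (P U.2) (P F.2) hM.
have dE : 0 <= wP * alpha_e * (vip U.1.2 U.1.2 + vip F.1.2 F.1.2).
  by rewrite mulr_ge0 ?addr_ge0// mulr_ge0// ltW.
have dM : 0 <= wM * alpha_m * (vip U.2 U.2 + vip F.2 F.2).
  by rewrite mulr_ge0 ?addr_ge0// mulr_ge0// ltW.
rewrite /sip /dissip /observability_const.
set cE := (_ + wP) / _ in bE *; set cM := (_ + wM) / _ in bM *.
have cE0 : 0 <= cE.
  by apply: divr_ge0; rewrite ?mulr_ge0 ?ltW// !addr_gt0// !mulr_gt0// exprn_gt0.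
have cM0 : 0 <= cM.
  by apply: divr_ge0; rewrite ?mulr_ge0 ?ltW// !addr_gt0// !mulr_gt0// exprn_gt0.
have := mulr_ge0 cE0 dM; have := mulr_ge0 cM0 dE; move: bE bM.
by rewrite !mulrDr !mulrDl; lra.
Qed.

Lemma generator_drude T : C0_semigroup (@state_norm R) T -> generates (@state_norm R) G T ->
  C0_semigroup (ipnorm sip) T /\ generates (ipnorm sip) G T.
Proof.
have N0 W : 0 <= state_norm W by rewrite state_normE sqrtr_ge0.
have h1 := sip_le_state_norm eps0_gt0 mu0_gt0 Omega_e_gt0 Omega_m_gt0.
have h2 := state_norm_le_sip eps0_gt0 mu0_gt0 Omega_e_gt0 Omega_m_gt0.
move=> TS TG; split.
  exact: (C0_semigroup_equiv (sqrtr_ge0 _) N0 (nrm_ge0 sip) h1 h2 TS).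
exact: (generates_equiv N0 (nrm_ge0 sip) h1 h2 TG).
Qed.

Section Solution.
Variable T : R -> X -> X.
Hypotheses (TS : C0_semigroup (ipnorm sip) T) (TG : generates (ipnorm sip) G T).

Lemma drude_resolvent : exists l, [/\ 0 < l,
  forall x, exists u, G u (l *: u - x) & forall u f, G u f -> sip u f = - dissip u u].
Proof.
have [M HM] := semigroup_bounded TS ler01.
(* Then [M < 1 + l <= exp l], as the exclusion of eigenvectors requires. *)
pose l := `|M| + 1.
have l0 : 0 < l by rewrite ltr_wpDl.
have large : exists2 M, forall v, ipnorm sip (T 1 v) <= M * ipnorm sip v & M < expR l.
  exists M => //; apply: lt_le_trans (expR_ge1Dx _).
  by rewrite /l; have := ler_norm M; lra.
have Dle := dissip_le eps0_gt0 mu0_gt0 Omega_e_gt0 Omega_m_gt0 alpha_e_gt0 alpha_m_gt0.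
have Jadj := @time_reversal_adjoint R eps0 mu0 Omega_e Omega_m.
have DJ := @dissip_time_reversal R eps0 mu0 Omega_e Omega_m alpha_e alpha_m.
have Jn := @time_reversal_norm R eps0 mu0 Omega_e Omega_m.
have CJ := @core_time_reversal R eps0 mu0 Omega_e Omega_m alpha_e alpha_m.
exists l; split=> // [x|u f].
  exact: (generator_range sipP dissipP sip_complete Dle TS TG adjoint core_sub Jadj DJ Jn CJ l0 large).
exact: (generator_green sipP dissipP sip_complete Dle TS TG adjoint core_sub Jadj DJ Jn CJ l0 large).
Qed.

Let dissip_ge0 u : 0 <= dissip u u. Proof. exact: (ip_ge0 dissipP). Qed.

Lemma drude_cvg0 u : sip (T t u) (T t u) @[t --> +oo] --> (0 : R).
Proof.
have [l [l0 range green]] := drude_resolvent.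
apply: (orbit_energy_cvg0 (q := fun u => dissip u u) (l := l) sipP sip_complete TS TG
  dissip_ge0 _ drude_observability l0 observability_const_gt0 range).
by move=> v f /green ->.
Qed.

(** The [l] of [drude_resolvent] depends on the growth of [T] but does not enter the bound, so the
    constant is uniform over all solutions. *)
Lemma drude_decay m (us : nat -> X) : (forall k, (k < m)%N -> G (us k) (us k.+1)) ->
  forall t, 0 < t -> sip (T t (us 0%N)) (T t (us 0%N)) <=
    decay_const observability_const m * (\sum_(k < m.+1) sip (us k) (us k)) * t ^- m.
Proof.
move=> usP t t0; have [l [l0 range green]] := drude_resolvent.
apply: (orbit_energy_decay (q := fun u => dissip u u) (l := l) sipP sip_complete TS TG
  dissip_ge0 _ drude_observability l0 observability_const_gt0 range) => //.
by move=> v f /green ->.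
Qed.

End Solution.
End DrudeDecay.

(** * Iterating the operator on Sobolev data *)

Section Jets.
Context {R : realType}.
Local Notation L2 := (Defs.L2 R).
Implicit Types (f g : L2) (a : multi_index) (i l : 'I_3) (phi : R * R * R -> R).

Lemma pairing_linear (c : R) f g phi : test_function phi ->
  pairing (c *: f + g) phi = c * pairing f phi + pairing g phi.
Proof. by move=> tphi; rewrite !(pairing_testL2 _ tphi) (ip_linearl (l2ip_is_ip _)). Qed.

Lemma pairingB f g phi : test_function phi ->
  pairing (f - g) phi = pairing f phi - pairing g phi.
Proof. by move=> tphi; rewrite !(pairing_testL2 _ tphi) (ipBl (l2ip_is_ip _)). Qed.

Definition weak_partial i f g := forall phi, test_function phi ->
  pairing f (partial i phi) = - pairing g phi.

Lemma weak_partial_linear i (c : R) f f' g g' : weak_partial i f f' -> weak_partial i g g' ->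
  weak_partial i (c *: f + g) (c *: f' + g').
Proof.
move=> hf hg phi tphi; rewrite !pairing_linear//; last exact: test_function_partial.
by rewrite hf// hg// mulrN opprD.
Qed.

Lemma weak_partial0 i : weak_partial i 0 0.
Proof.
move=> phi tphi; have tphi' := test_function_partial i tphi.
by rewrite (pairing_testL2 _ tphi) (pairing_testL2 _ tphi') !(ip0l (l2ip_is_ip _)) oppr0.
Qed.

Lemma weak_partialZ i (c : R) f f' : weak_partial i f f' -> weak_partial i (c *: f) (c *: f').
Proof. by move=> h; have := weak_partial_linear c h (weak_partial0 i); rewrite !addr0. Qed.

Lemma weak_partialB i f f' g g' : weak_partial i f f' -> weak_partial i g g' ->
  weak_partial i (f - g) (f' - g').
Proof.
by move=> hf hg; have := weak_partial_linear (-1) hg hf; rewrite !scaleN1r !(addrC (- _)).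
Qed.

Definition shift i a : multi_index := [ffun k => (a k + (k == i))%N].

Lemma shiftC i l a : shift i (shift l a) = shift l (shift i a).
Proof. by apply/ffunP => k; rewrite !ffunE addnAC. Qed.

Lemma mi_order_shift i a : mi_order (shift i a) = (mi_order a).+1.
Proof.
rewrite /mi_order (eq_bigr (fun k => a k + (k == i))%N); last by move=> k _; rewrite ffunE.
have s1 : (\sum_(k < 3) (k == i) = 1)%N.
  by rewrite (bigD1 i)//= eqxx big1// => k /negbTE ->.
by rewrite big_split/= s1 addn1.
Qed.

Lemma test_function_iter_partial n i phi : test_function phi -> test_function (iter n (partial i) phi).
Proof. by move=> tphi; elim: n => //= n; exact: test_function_partial. Qed.

Lemma partial_iter n i l phi : test_function phi ->
  partial i (iter n (partial l) phi) = iter n (partial l) (partial i phi).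
Proof.
move=> tphi; elim: n => //= n <-; apply: partial_comm.
exact: test_function_iter_partial.
Qed.

(** [iter_partial] differentiates in a fixed order of the coordinates, so the derivative applied
    first has to be commuted outwards into its own block. *)
Lemma iter_partial_shift i a phi : test_function phi ->
  iter_partial a (partial i phi) = iter_partial (shift i a) phi.
Proof.
move=> tphi; have t n l psi := @test_function_iter_partial n l psi.
have i0 : (inord 1 : 'I_3) == ord0 = false by rewrite -val_eqE /= inordK.
have i2 : (inord 1 : 'I_3) == ord_max = false by rewrite -val_eqE /= inordK.
have [->|[->|->]] : i = ord0 \/ i = inord 1 \/ i = ord_max.
- case: i => -[|[|[|//]]] h; [left|right; left|right; right]; apply/val_inj => //=.
  by rewrite inordK.
- rewrite /iter_partial !ffunE eqxx i0 !addn0 addn1 iterSr.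
  by rewrite -(partial_iter (a ord_max) ord0 ord_max tphi) -(partial_iter _ ord0 (inord 1) (t _ _ _ tphi)).
- rewrite /iter_partial !ffunE eqxx (eq_sym ord0) (eq_sym ord_max) i0 i2 !addn0 addn1 iterSr.
  by rewrite -(partial_iter (a ord_max) (inord 1) ord_max tphi).
- rewrite /iter_partial !ffunE eqxx i2 !addn0 addn1 iterSr.
  by [].
Qed.

Lemma weak_derivativeP m f a : sobolev m f -> (mi_order a <= m)%N ->
  is_weak_derivative a f (weak_derivative a f).
Proof. by move=> fm am; have [g hg] := fm a am; exact: (xgetPex 0 (ex_intro _ g hg)). Qed.

Lemma weak_derivative_shift m f a i : sobolev m f -> (mi_order a < m)%N ->
  weak_partial i (weak_derivative a f) (weak_derivative (shift i a) f).
Proof.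
move=> fm am phi tphi.
have := weak_derivativeP fm (ltnW am) (test_function_partial i tphi).
rewrite iter_partial_shift// (weak_derivativeP fm _ tphi); last by rewrite mi_order_shift.
rewrite mi_order_shift exprS mulN1r mulNr -mulrN.
have u : (-1 : R) ^+ mi_order a != 0 by rewrite expf_neq0// oppr_eq0 oner_neq0.
by move/(mulfI u).
Qed.

Lemma weak_derivative0_pairing f phi : sobolev 0 f -> test_function phi ->
  pairing f phi = pairing (weak_derivative [ffun=> 0%N] f) phi.
Proof.
move=> f0 tphi; have z : mi_order [ffun=> 0%N] = 0%N by rewrite /mi_order big1// => i _; rewrite ffunE.
have := @weak_derivativeP 0 f [ffun=> 0%N] f0 _ phi tphi.
by rewrite z /iter_partial !ffunE expr0 mul1r; exact.
Qed.

Lemma weak_derivative_le_sobolev m f a : (mi_order a <= m)%N ->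
  L2norm (weak_derivative a f) ^+ 2 <= sobolev_normsq m f.
Proof.
move=> am.
have lem i : (a i < m.+1)%N.
  by rewrite ltnS (leq_trans _ am)// /mi_order (bigD1 i)//= leq_addr.
pose b : {ffun 'I_3 -> 'I_m.+1} := [ffun i => Ordinal (lem i)].
have ba : to_multi_index b = a by apply/ffunP => i; rewrite !ffunE.
rewrite /sobolev_normsq (bigD1 b)/= ?ba// lerDl.
by apply: sumr_ge0 => c _; exact: sqr_ge0.
Qed.

(** A state stored with its weak derivatives, only those up to a given order being meaningful. A
    curl becomes a difference of entries, so the operator can be iterated algebraically, each
    application costing one order. *)
Definition jet : Type := multi_index -> state R.

Definition jet_consistent m (j : jet) := forall a, (mi_order a < m)%N -> forall i l,
  [/\ weak_partial i ((j a).1.1.1 l) ((j (shift i a)).1.1.1 l),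
      weak_partial i ((j a).1.1.2 l) ((j (shift i a)).1.1.2 l),
      weak_partial i ((j a).1.2 l) ((j (shift i a)).1.2 l) &
      weak_partial i ((j a).2 l) ((j (shift i a)).2 l)].

Definition jet_bounded m (B : R) (j : jet) := forall a, (mi_order a <= m)%N -> forall l,
  [/\ ipnorm (@l2ip _ _ R (leb3 R)) ((j a).1.1.1 l) <= B,
      ipnorm (@l2ip _ _ R (leb3 R)) ((j a).1.1.2 l) <= B,
      ipnorm (@l2ip _ _ R (leb3 R)) ((j a).1.2 l) <= B &
      ipnorm (@l2ip _ _ R (leb3 R)) ((j a).2 l) <= B].

Definition jet_curl (u : multi_index -> vfield R) a : vfield R :=
  [ffun i => u (shift (ordS i) a) (ordS (ordS i)) - u (shift (ordS (ordS i)) a) (ordS i)].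

Lemma jet_curlE (u : multi_index -> vfield R) a i : jet_curl u a i =
  u (shift (ordS i) a) (ordS (ordS i)) - u (shift (ordS (ordS i)) a) (ordS i).
Proof. by rewrite ffunE. Qed.

Lemma vfieldZB (c d : R) (u v : vfield R) l : (c *: u - d *: v) l = c *: u l - d *: v l.
Proof. by rewrite ffunE; congr (_ + _); rewrite ?ffunE. Qed.

Lemma vfieldB (d : R) (u v : vfield R) l : (u - d *: v) l = u l - d *: v l.
Proof. by rewrite -[u]scale1r vfieldZB !scale1r. Qed.

Lemma is_curl_jet (u : multi_index -> vfield R) a :
  (forall i l, weak_partial i (u a l) (u (shift i a) l)) -> is_curl (u a) (jet_curl u a).
Proof.
by move=> hu phi tphi i /=; rewrite !hu// ffunE pairingB//; ring.
Qed.

Variables (eps0 mu0 Omega_e Omega_m alpha_e alpha_m : R).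

Definition jet_step (j : jet) : jet := fun a =>
  (eps0^-1 *: jet_curl (fun b => (j b).1.1.2) a - Omega_e ^+ 2 *: (j a).1.2,
   - (mu0^-1 *: jet_curl (fun b => (j b).1.1.1) a) - Omega_m ^+ 2 *: (j a).2,
   (j a).1.1.1 - alpha_e *: (j a).1.2,
   (j a).1.1.2 - alpha_m *: (j a).2).

Lemma jet_step_operator m j a : jet_consistent m j -> (mi_order a < m)%N ->
  drude_operator eps0 mu0 Omega_e Omega_m alpha_e alpha_m (j a) (jet_step j a).
Proof.
move=> jm am; rewrite /jet_step.
have hE := @is_curl_jet (fun b => (j b).1.1.1) a (fun i l => let: And4 h _ _ _ := jm a am i l in h).
have hH := @is_curl_jet (fun b => (j b).1.1.2) a (fun i l => let: And4 _ h _ _ := jm a am i l in h).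
move: (jet_curl _ a) (jet_curl _ a) hE hH => rH rE.
case: (j a) => [[[E H] P] M] /= hE hH.
by exists rE, rH; split=> //; exact: (null_state_refl erefl erefl erefl erefl).
Qed.

Lemma jet_stepE j a l : [/\
  (jet_step j a).1.1.1 l = eps0^-1 *: ((j (shift (ordS l) a)).1.1.2 (ordS (ordS l)) -
    (j (shift (ordS (ordS l)) a)).1.1.2 (ordS l)) - Omega_e ^+ 2 *: (j a).1.2 l,
  (jet_step j a).1.1.2 l = - mu0^-1 *: ((j (shift (ordS l) a)).1.1.1 (ordS (ordS l)) -
    (j (shift (ordS (ordS l)) a)).1.1.1 (ordS l)) - Omega_m ^+ 2 *: (j a).2 l,
  (jet_step j a).1.2 l = (j a).1.1.1 l - alpha_e *: (j a).1.2 l &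
  (jet_step j a).2 l = (j a).1.1.2 l - alpha_m *: (j a).2 l].
Proof.
rewrite /jet_step; split.
- by rewrite -(jet_curlE (fun b => (j b).1.1.2)); exact: vfieldZB.
- by rewrite -(jet_curlE (fun b => (j b).1.1.1)) -vfieldZB scaleNr.
- exact: vfieldB.
- exact: vfieldB.
Qed.

(** An entry of a curl uses entries of the next order, whence the loss of one; [shiftC] makes the
    derivative of a curl entry the curl entry of the derivative. *)
Lemma jet_step_consistent m j : jet_consistent m.+1 j -> jet_consistent m (jet_step j).
Proof.
move=> jm a am i l.
have am1 : (mi_order a < m.+1)%N by rewrite ltnS ltnW.
have h0 := jm a am1.
have sh k : (mi_order (shift k a) < m.+1)%N by rewrite mi_order_shift.
have [hE hH hP hM] := h0 i l.
have c (k k' : 'I_3) := jm (shift k a) (sh k) i k'.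
have [E1 H1 _ _] := c (ordS l) (ordS (ordS l)); have [E2 H2 _ _] := c (ordS (ordS l)) (ordS l).
rewrite !(shiftC i) in E1 H1 E2 H2.
move: (jet_step j a) (jet_step j (shift i a)) (jet_stepE j a l) (jet_stepE j (shift i a) l).
move=> S S' [-> -> -> ->] [-> -> -> ->].
split.
- by apply: weak_partialB; apply: weak_partialZ => //; exact: weak_partialB.
- by apply: weak_partialB; apply: weak_partialZ => //; exact: weak_partialB.
- by apply: weak_partialB => //; exact: weak_partialZ.
- by apply: weak_partialB => //; exact: weak_partialZ.
Qed.

(** It dominates the sum of the absolute coefficients in each row of the operator: the factors 2
    count the two terms of a curl component, the final 1 is the coefficient of [E] or [H] in the
    damped equations. *)
Definition jet_const : R := 2 * `|eps0^-1| + 2 * `|mu0^-1| + Omega_e ^+ 2 + Omega_m ^+ 2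
  + `|alpha_e| + `|alpha_m| + 1.

Lemma jet_const_gt0 : 0 < jet_const.
Proof.
have := normr_ge0 eps0^-1; have := normr_ge0 mu0^-1; have := normr_ge0 alpha_e.
have := normr_ge0 alpha_m; have := sqr_ge0 Omega_e; have := sqr_ge0 Omega_m.
rewrite /jet_const; lra.
Qed.

Lemma jet_step_bounded m B j : 0 <= B -> jet_bounded m.+1 B j ->
  jet_bounded m (jet_const * B) (jet_step j).
Proof.
move=> B0 jm a am l.
have nP := l2ip_is_ip (leb3 R).
have am1 : (mi_order a <= m.+1)%N by exact: leqW.
have [hE hH hP hM] := jm a am1 l.
have sh k : (mi_order (shift k a) <= m.+1)%N by rewrite mi_order_shift.
have h1 k k' := jm (shift k a) (sh k) k'.
have [E1 H1 _ _] := h1 (ordS l) (ordS (ordS l)); have [E2 H2 _ _] := h1 (ordS (ordS l)) (ordS l).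
move: (jet_step j a) (jet_stepE j a l) => S [-> -> -> ->].
have nB (x y : L2) (p q : R) : ipnorm (@l2ip _ _ R (leb3 R)) x <= p ->
    ipnorm (@l2ip _ _ R (leb3 R)) y <= q -> ipnorm (@l2ip _ _ R (leb3 R)) (x - y) <= p + q.
  by move=> hx hy; apply: le_trans (ler_nrmD nP _ _) _; rewrite (nrmN nP) lerD.
have nZ (c : R) (x : L2) (p : R) : ipnorm (@l2ip _ _ R (leb3 R)) x <= p ->
    ipnorm (@l2ip _ _ R (leb3 R)) (c *: x) <= `|c| * p.
  by move=> hx; rewrite (nrmZ nP) ler_wpM2l.
have e0 := mulr_ge0 (normr_ge0 eps0^-1) B0; have m0 := mulr_ge0 (normr_ge0 mu0^-1) B0.
have ae0 := mulr_ge0 (normr_ge0 alpha_e) B0; have am0 := mulr_ge0 (normr_ge0 alpha_m) B0.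
have oe0 := mulr_ge0 (sqr_ge0 Omega_e) B0; have om0 := mulr_ge0 (sqr_ge0 Omega_m) B0.
have noe : `|Omega_e ^+ 2| = Omega_e ^+ 2 by rewrite ger0_norm// sqr_ge0.
have nom : `|Omega_m ^+ 2| = Omega_m ^+ 2 by rewrite ger0_norm// sqr_ge0.
rewrite /jet_const; split.
- have := nB _ _ _ _ (nZ eps0^-1 _ _ (nB _ _ _ _ H1 H2)) (nZ (Omega_e ^+ 2) _ _ hP).
  by rewrite noe => /le_trans; apply; rewrite !mulrDl; lra.
- have := nB _ _ _ _ (nZ (- mu0^-1) _ _ (nB _ _ _ _ E1 E2)) (nZ (Omega_m ^+ 2) _ _ hM).
  by rewrite nom normrN => /le_trans; apply; rewrite !mulrDl; lra.
- by have := nB _ _ _ _ hE (nZ alpha_e _ _ hP) => /le_trans; apply; rewrite !mulrDl; lra.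
- by have := nB _ _ _ _ hH (nZ alpha_m _ _ hM) => /le_trans; apply; rewrite !mulrDl; lra.
Qed.

End Jets.

(** * Decay rate for Sobolev initial data *)

Section SobolevData.
Context {R : realType} (eps0 mu0 Omega_e Omega_m alpha_e alpha_m : R).
Hypotheses (eps0_gt0 : 0 < eps0) (mu0_gt0 : 0 < mu0)
  (Omega_e_gt0 : 0 < Omega_e) (Omega_m_gt0 : 0 < Omega_m)
  (alpha_e_gt0 : 0 < alpha_e) (alpha_m_gt0 : 0 < alpha_m).
Local Notation X := (state R).
Local Notation L2 := (Defs.L2 R).
Local Notation G := (drude_operator eps0 mu0 Omega_e Omega_m alpha_e alpha_m).
Local Notation wP := (wP eps0 Omega_e).
Local Notation wM := (wM mu0 Omega_m).
Local Notation sip := (sip eps0 mu0 Omega_e Omega_m).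
Local Notation sipP := (sip_is_ip eps0_gt0 mu0_gt0 Omega_e_gt0 Omega_m_gt0).
Local Notation adjoint := (drude_adjoint alpha_e alpha_m eps0_gt0 mu0_gt0 Omega_e_gt0 Omega_m_gt0).
Local Notation vipP := (@vip_is_ip R).
Local Notation ip0E := (ip0l (@vip_is_ip R), ip0r (@vip_is_ip R)).
Local Notation L2P := (l2ip_is_ip (leb3 R)).
Local Notation nrm2 := (ipnorm (@l2ip _ _ R (leb3 R))).
Local Notation step := (jet_step eps0 mu0 Omega_e Omega_m alpha_e alpha_m).
Local Notation jconst := (jet_const eps0 mu0 Omega_e Omega_m alpha_e alpha_m).

Section Chain.
Variable T : R -> X -> X.
Hypotheses (TS : C0_semigroup (ipnorm sip) T) (TG : generates (ipnorm sip) G T).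

(* The generator is single-valued, while a field that vanishes as a distribution
   is one of the curls of 0; hence it vanishes almost everywhere. *)
Lemma distribution_null (f : L2) :
  (forall phi, test_function phi -> pairing f phi = 0) -> nrm2 f = 0.
Proof.
move=> hf.
have G0 : G 0 0.
  by apply/adjoint => V K _; rewrite !(ip0l sipP) /dissip !ip0E !mulr0 addr0 mulr0 oppr0.
have Gf : G 0 (single ord0 f, 0, 0, 0).
  apply/adjoint => V K; case=> [i phi tphi|i phi tphi|p|p];
    rewrite (ip0l sipP) /sip /dissip /= !ip0E !mulr0 !addr0 !mulr0 oppr0//.
  rewrite vip_single ffunE; case: ifP => _; last by rewrite (ip0l L2P) mulr0.
  by rewrite -pairing_testL2 hf// mulr0.
have := generator_uniq sipP TG Gf G0; rewrite /null_eq subr0 => /(congr1 (fun x => x ^+ 2)).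
rewrite (sqr_nrm sipP) /sip /= !ip0E !mulr0 !addr0 vip_single ffunE eqxx expr0n/= => h.
by apply/eqP; rewrite -sqrf_eq0 (sqr_nrm L2P) -(mulrI_eq0 _ (mulfI (lt0r_neq0 eps0_gt0))) h.
Qed.

(** The representative chosen at order 0 agrees with [f] a priori only as a distribution. *)
Lemma weak_derivative0 (f : L2) : sobolev 0 f ->
  nrm2 (f - weak_derivative [ffun=> 0%N] f) = 0.
Proof.
move=> f0; apply: distribution_null => phi tphi.
by rewrite pairingB// (weak_derivative0_pairing f0 tphi) subrr.
Qed.

Definition sobolev_jet (E0 H0 : vfield R) : jet := fun a =>
  ([ffun l => weak_derivative a (E0 l)], [ffun l => weak_derivative a (H0 l)], 0, 0).

Lemma sobolev_le0 m (f : L2) : sobolev m f -> sobolev 0 f.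
Proof. by move=> h a a0; apply: h; apply: leq_trans a0 _. Qed.

Lemma sobolev_jet0 m (E0 H0 : vfield R) : vsobolev m E0 -> vsobolev m H0 ->
  null_eq (ipnorm sip) (E0, H0, 0, 0) (sobolev_jet E0 H0 [ffun=> 0%N]).
Proof.
move=> hE hH; rewrite /null_eq /sobolev_jet.
have z (u : vfield R) : vsobolev m u ->
    vip (u - [ffun l => weak_derivative [ffun=> 0%N] (u l)])
        (u - [ffun l => weak_derivative [ffun=> 0%N] (u l)]) = 0.
  move=> hu; apply: big1 => l _.
  have -> : (u - [ffun l => weak_derivative [ffun=> 0%N] (u l)]) l =
      u l - weak_derivative [ffun=> 0%N] (u l) by rewrite !ffunE.
  by rewrite -(sqr_nrm L2P) (weak_derivative0 (sobolev_le0 (hu l))) expr0n.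
rewrite /ipnorm /sip /= !subr0 !ip0E (z _ hE) (z _ hH).
by rewrite !mulr0 !addr0 sqrtr0.
Qed.

Lemma sobolev_jet_consistent m (E0 H0 : vfield R) : vsobolev m E0 -> vsobolev m H0 ->
  jet_consistent m (sobolev_jet E0 H0).
Proof.
move=> hE hH a am i l; split=> /=.
- by rewrite !ffunE; exact: (weak_derivative_shift _ (hE l)).
- by rewrite !ffunE; exact: (weak_derivative_shift _ (hH l)).
- by rewrite ffunE; exact: weak_partial0.
- by rewrite ffunE; exact: weak_partial0.
Qed.

Lemma sobolev_jet_bounded m (E0 H0 : vfield R) :
  jet_bounded m (Num.sqrt (vsobolev_normsq m E0 + vsobolev_normsq m H0)) (sobolev_jet E0 H0).
Proof.
have s0 (f : L2) : 0 <= sobolev_normsq m f by apply: sumr_ge0 => a _; exact: sqr_ge0.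
have v0 (u : vfield R) : 0 <= vsobolev_normsq m u by apply: sumr_ge0.
have vl (u : vfield R) l : sobolev_normsq m (u l) <= vsobolev_normsq m u.
  by rewrite /vsobolev_normsq (bigD1 l)//= lerDl; apply: sumr_ge0.
have w (u : vfield R) l a : (mi_order a <= m)%N ->
    l2ip (weak_derivative a (u l)) (weak_derivative a (u l)) <= vsobolev_normsq m u.
  move=> am; rewrite -l2norm_sqr; apply: le_trans (vl u l).
  exact: weak_derivative_le_sobolev.
move=> a am l; split=> /=.
- by rewrite ffunE; apply: ler_wsqrtr; apply: (le_trans (w _ _ _ am)); rewrite lerDl.
- by rewrite ffunE; apply: ler_wsqrtr; apply: (le_trans (w _ _ _ am)); rewrite lerDr.
- by rewrite ffunE (nrm0 L2P) sqrtr_ge0.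
- by rewrite ffunE (nrm0 L2P) sqrtr_ge0.
Qed.

Lemma jet_iter m k (B : R) j : 0 <= B -> (k <= m)%N -> jet_consistent m j -> jet_bounded m B j ->
  jet_consistent (m - k) (iter k step j) /\ jet_bounded (m - k) (jconst ^+ k * B) (iter k step j).
Proof.
move=> B0; elim: k => [|k IH] km jc jb; first by rewrite subn0 expr0 mul1r.
have [hc hb] := IH (ltnW km) jc jb.
have mk : (m - k = (m - k.+1).+1)%N by rewrite subnS prednK// subn_gt0.
rewrite mk in hc hb; split; first exact: jet_step_consistent.
rewrite exprS -mulrA; apply: jet_step_bounded hb.
by rewrite mulr_ge0// exprn_ge0// ltW// jet_const_gt0.
Qed.

Lemma jet_bounded_sip m (B : R) j a : 0 <= B -> jet_bounded m B j -> (mi_order a <= m)%N ->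
  sip (j a) (j a) <= 3 * (eps0 + mu0 + wP + wM) * B ^+ 2.
Proof.
move=> B0 jb am; have {}jb := jb a am.
have v (u : vfield R) : (forall l, nrm2 (u l) <= B) -> vip u u <= 3 * B ^+ 2.
  move=> hu; rewrite /vip (@le_trans _ _ (\sum_(l < 3) B ^+ 2))//.
    apply: ler_sum => l _; rewrite -(sqr_nrm L2P).
    by rewrite ler_pXn2r ?nnegrE ?nrm_ge0.
  by rewrite sumr_const card_ord mulr_natl.
have v1 := v _ (fun l => let: And4 h _ _ _ := jb l in h).
have v2 := v _ (fun l => let: And4 _ h _ _ := jb l in h).
have v3 := v _ (fun l => let: And4 _ _ h _ := jb l in h).
have v4 := v _ (fun l => let: And4 _ _ _ h := jb l in h).
have e (w x : R) : 0 < w -> x <= 3 * B ^+ 2 -> w * x <= w * (3 * B ^+ 2) by move=> w0; rewrite ler_pM2l.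
have -> : 3 * (eps0 + mu0 + wP + wM) * B ^+ 2 = eps0 * (3 * B ^+ 2) + mu0 * (3 * B ^+ 2) +
    wP * (3 * B ^+ 2) + wM * (3 * B ^+ 2) by ring.
rewrite /sip; apply: lerD; [apply: lerD; [apply: lerD|]|]; apply: e => //.
- exact: wP_gt0.
- exact: wM_gt0.
Qed.

(** The [k]-th iterate of the operator has components of norm at most [jconst ^+ k] times the
    Sobolev norm of the data; the 3 counts the components of a field. *)
Definition sobolev_const m : R := decay_const (observability_const eps0 mu0 Omega_e Omega_m alpha_e alpha_m) m *
  (\sum_(k < m.+1) 3 * (eps0 + mu0 + wP + wM) * (jconst ^+ k) ^+ 2).

Lemma sobolev_const_gt0 m : 0 < sobolev_const m.
Proof.
have p0 := wP_gt0 eps0_gt0 Omega_e_gt0; have q0 := wM_gt0 mu0_gt0 Omega_m_gt0.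
rewrite mulr_gt0 ?decay_const_gt0 ?observability_const_gt0//.
have t k : 0 < 3 * (eps0 + mu0 + wP + wM) * (jconst ^+ k) ^+ 2.
  by rewrite !mulr_gt0 ?addr_gt0 ?exprn_gt0 ?jet_const_gt0.
by rewrite big_ord_recl ltr_pwDl//; apply: sumr_ge0 => k _; exact: ltW.
Qed.

Lemma sobolev_decay m (E0 H0 : vfield R) : vsobolev m E0 -> vsobolev m H0 ->
  forall t, 0 < t -> sip (T t (E0, H0, 0, 0)) (T t (E0, H0, 0, 0)) <=
    sobolev_const m * (vsobolev_normsq m E0 + vsobolev_normsq m H0) * t ^- m.
Proof.
move=> hE hH t t0.
set S := vsobolev_normsq m E0 + _.
have S0 : 0 <= S.
  by apply: addr_ge0; apply: sumr_ge0 => l _; apply: sumr_ge0 => a _; exact: sqr_ge0.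
pose j := sobolev_jet E0 H0.
(* The order 0 entries of the iterated jets form the chain of images under the generator; its start
   is the initial state up to a null vector. *)
pose us k := iter k step j [ffun=> 0%N].
have z : mi_order [ffun=> 0%N] = 0%N by rewrite /mi_order big1// => i _; rewrite ffunE.
have ji k km := jet_iter (k := k) (sqrtr_ge0 S) km (sobolev_jet_consistent hE hH) (@sobolev_jet_bounded m E0 H0).
have usG k : (k < m)%N -> G (us k) (us k.+1).
  by move=> km; apply: (jet_step_operator _ _ _ _ _ _ (ji k (ltnW km)).1); rewrite z subn_gt0.
have -> : sip (T t (E0, H0, 0, 0)) (T t (E0, H0, 0, 0)) = sip (T t (us 0%N)) (T t (us 0%N)).
  rewrite -!(sqr_nrm sipP); congr (_ ^+ 2); apply: (nrm_eq sipP).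
  exact: (semigroup_null sipP TS (ltW t0) (sobolev_jet0 hE hH)).
apply: le_trans (drude_decay eps0_gt0 mu0_gt0 Omega_e_gt0 Omega_m_gt0 alpha_e_gt0 alpha_m_gt0 TS TG usG t0) _.
rewrite ler_pM2r ?invr_gt0 ?exprn_gt0// /sobolev_const -mulrA.
rewrite ler_pM2l ?decay_const_gt0 ?observability_const_gt0// mulr_suml.
apply: ler_sum => k _.
have km : (k <= m)%N by rewrite -ltnS.
have jb := (ji k km).2.
apply: le_trans (jet_bounded_sip _ jb _) _; rewrite ?z//.
  by rewrite mulr_ge0 ?sqrtr_ge0// exprn_ge0// ltW// jet_const_gt0.
by rewrite exprMn sqr_sqrtr// mulrA.
Qed.

End Chain.
End SobolevData.

Theorem theorem2p4 (R : realType)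
    (eps0 mu0 Omega_e Omega_m alpha_e alpha_m : R)
    (eps0_gt0 : 0 < eps0) (mu0_gt0 : 0 < mu0)
    (Omega_e_gt0 : 0 < Omega_e) (Omega_m_gt0 : 0 < Omega_m)
    (alpha_e_gt0 : 0 < alpha_e) (alpha_m_gt0 : 0 < alpha_m) :
  (forall (E0 H0 : vfield R) (U : R -> state R),
     drude_solution eps0 mu0 Omega_e Omega_m alpha_e alpha_m E0 H0 U ->
     energy eps0 mu0 Omega_e Omega_m (U t) @[t --> +oo] --> (0 : R)) /\
  (forall m : nat, (0 < m)%N ->
     exists C : R, 0 < C /\
       forall (E0 H0 : vfield R) (U : R -> state R),
         drude_solution eps0 mu0 Omega_e Omega_m alpha_e alpha_m E0 H0 U ->
         vsobolev m E0 -> vsobolev m H0 ->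
         forall t : R, 0 < t ->
           energy eps0 mu0 Omega_e Omega_m (U t)
           <= C * (vsobolev_normsq m E0 + vsobolev_normsq m H0) * t ^- m).
Proof.
pose ip := @sip R eps0 mu0 Omega_e Omega_m.
have ipP : is_ip ip := sip_is_ip eps0_gt0 mu0_gt0 Omega_e_gt0 Omega_m_gt0.
have solution E0 H0 U : drude_solution eps0 mu0 Omega_e Omega_m alpha_e alpha_m E0 H0 U ->
    exists T, [/\ C0_semigroup (ipnorm ip) T,
      generates (ipnorm ip) (drude_operator eps0 mu0 Omega_e Omega_m alpha_e alpha_m) T &
      forall t, 0 <= t -> energy eps0 mu0 Omega_e Omega_m (U t) =
        2^-1 * ip (T t (E0, H0, 0, 0)) (T t (E0, H0, 0, 0))].
  move=> [T [TS TG UT]]; exists T.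
  have [TS' TG'] := generator_drude eps0_gt0 mu0_gt0 Omega_e_gt0 Omega_m_gt0 TS TG.
  split=> // t t0; rewrite energyE; congr (_ * _).
  have /(state_norm_sip_null eps0_gt0 mu0_gt0 Omega_e_gt0 Omega_m_gt0) h := UT t t0.
  by rewrite -[LHS](sqr_nrm ipP) -[RHS](sqr_nrm ipP); congr (_ ^+ 2); exact: (nrm_eq ipP h).
split=> [E0 H0 U /solution[T [TS TG UT]]|m m0].
  have h := drude_cvg0 eps0_gt0 mu0_gt0 Omega_e_gt0 Omega_m_gt0 alpha_e_gt0 alpha_m_gt0 TS TG (E0, H0, 0, 0).
  have h2 : 2^-1 * ip (T t (E0, H0, 0, 0)) (T t (E0, H0, 0, 0)) @[t --> +oo] --> (0 : R).
    by rewrite -[X in _ --> X](mulr0 (2^-1 : R)); apply: cvgM; [exact: cvg_cst|exact: h].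
  apply: cvg_trans h2; apply: near_eq_cvg.
  by exists 0; split; [exact: num_real|move=> t t0; rewrite UT// ltW].
have c0 := sobolev_const_gt0 eps0_gt0 mu0_gt0 Omega_e_gt0 Omega_m_gt0 alpha_e_gt0 alpha_m_gt0 m.
exists (2^-1 * sobolev_const eps0 mu0 Omega_e Omega_m alpha_e alpha_m m); split.
  by rewrite mulr_gt0// invr_gt0.
move=> E0 H0 U /solution[T [TS TG UT]] hE hH t t0.
have main := sobolev_decay eps0_gt0 mu0_gt0 Omega_e_gt0 Omega_m_gt0 alpha_e_gt0 alpha_m_gt0 TS TG hE hH t0.
rewrite (UT _ (ltW t0)); apply: le_trans (ler_wpM2l _ main) _; first by rewrite invr_ge0.
by rewrite !mulrA.
Qed.
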